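(* Let $\{M_i\}_{i\in\mathbb{N}}$ be a sequence of smooth closed orientable $d$-dimensional submanifolds of $\mathbb{R}^D$ converging to a smooth closed orientable submanifold $M_\infty\subset\mathbb{R}^D$ in the Whitney $C^1$ topology. Fix $c>0$. Then for every field $\mathbb{k}$ and every $j\in\mathbb{N}\cup\{0\}$, $$\lim_{i\to\infty} d_I\Bigl(H_j\bigl(\check{\mathbb{C}}(M_i,\mathbb{R}^D\times\mathbf{Gr}_c^+(D,d));\mathbb{k}\bigr),\ H_j\bigl(\check{\mathbb{C}}(M_\infty,\mathbb{R}^D\times\mathbf{Gr}_c^+(D,d));\mathbb{k}\bigr)\Bigr)=0,$$ where $d_I$ denotes the interleaving distance between persistence modules.
   Context: Closed means compact without boundary; each orientable submanifold carries an orientation, used to define its Gauss map. $\mathbf{Gr}^+(D,d)$ is the Grassmannian of oriented $d$-dimensional subspaces of $\mathbb{R}^D$, with the Riemannian metric $g^{\mathbf{Gr}^+(D,d)}$ making the forgetful double cover to $\mathbf{Gr}(D,d)$ a local isometry, where $\mathbf{Gr}(D,d)$ has the metric given on $T_P\mathbf{Gr}(D,d)\cong\mathrm{Hom}(P,P^\perp)$ by the Hilbert--Schmidt inner product (its geodesic distance is the square root of the sum of squared principal angles). For $c>0$, $\mathbf{Gr}_c^+(D,d)$ is the same manifold with metric $c\cdot g^{\mathbf{Gr}^+(D,d)}$. For a closed oriented $d$-dimensional submanifold $N\subset\mathbb{R}^D$, the Gauss map $\bar{\mathbf{g}}_c^+:N\to\mathbf{Gr}_c^+(D,d)$ sends $p$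 to the oriented tangent space $T_pN$ translated to the origin, and $N$ is regarded as a subset of $\mathbb{R}^D\times\mathbf{Gr}_c^+(D,d)$ (with the product Riemannian distance) via $q\mapsto(q,\bar{\mathbf{g}}_c^+(q))$. For a subset $Y$ of a metric space $Z$, the ambient Čech complex $\check{C}(Y,Z;r)$ is the nerve of the family of balls $\{B_Z(y,r)\}_{y\in Y}$ in $Z$, and $\check{\mathbb{C}}(Y,Z)$ is the filtration $\{\check{C}(Y,Z;r)\}_{r\geq 0}$ with the inclusion maps. $H_j(\cdot;\mathbb{k})$ denotes the resulting persistence module (vector spaces $H_j(\check{C}(Y,Z;r);\mathbb{k})$ with maps induced by inclusions). Two persistence modules $\mathbb{V}=(V_i,v_i^j)$, $\mathbb{W}=(W_i,w_i^j)$ over $\mathbb{R}_{\ge0}$ are $\varepsilon$-interleaved if there are families of linear maps $\phi_i:V_i\to W_{i+\varepsilon}$, $\psi_i:W_i\to V_{i+\varepsilon}$ commuting with the structure maps with $\psi_{i+\varepsilon}\circ\phi_i=v_i^{i+2\varepsilon}$ and $\phi_{i+\varepsilon}\circ\psi_i=w_i^{i+2\varepsilon}$ for all $i\ge 0$; $d_I(\mathbb{V},\mathbb{W})$ is the infimum of $\varepsilon\ge0$ such that they are $\varepsilon$-interleaved. Whitney $C^1$ convergence: there are a fixed smooth closed manifold $M$ and smooth embeddings $F_i:M\to\mathbb{R}^D$ with $M_i=F_i(M)$, and an embedding $F_\infty:M\to\mathbb{R}^D$ with $M_\infty=F_\infty(M)$, such that $F_i\to F_\infty$ in the Whitney $C^1$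 topology: there exist locally finite atlases $\{(U_\alpha,\varphi_\alpha)\}$ of $M$ and $\{(V_\alpha,\psi_\alpha)\}$ of $\mathbb{R}^D$ with $F_\infty(U_\alpha)\subset V_\alpha$ such that for each $\alpha$ and each $\varepsilon_\alpha>0$ there is $n_\alpha$ such that for all $i\ge n_\alpha$ $$\max_{|\beta|\le1}\sup_{x\in\varphi_\alpha(U_\alpha)}\bigl\|D^\beta(\psi_\alpha\circ F_i\circ\varphi_\alpha^{-1})(x)-D^\beta(\psi_\alpha\circ F_\infty\circ\varphi_\alpha^{-1})(x)\bigr\|_2<\varepsilon_\alpha.$$
   Formalization: The manifolds are assumed nonempty, and either connected or oriented so that each diffeomorphism from M_∞ to M_i preserves or reverses orientation globally; with unrelated orientations on the components of a disconnected manifold the claim is false (e.g. two concentric circles). *)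

(* Defs.v *)
From HB Require Import structures.
From mathcomp Require Import all_boot all_order all_algebra all_fingroup.
From mathcomp Require Import generic_quotient ring_quotient.
From mathcomp Require Import all_classical all_reals all_analysis.

Set Implicit Arguments.
Unset Strict Implicit.
Unset Printing Implicit Defensive.
Import Order.TTheory GRing.Theory Num.Theory.
Import numFieldNormedType.Exports.
Local Open Scope classical_set_scope.
Local Open Scope ring_scope.

Record submodule (k : pzRingType) (V : lmodType k) := Submodule {
  submodule_set :> V -> Prop;
  submodule0 : submodule_set 0;
  submoduleZD : forall a u v,
    submodule_set u -> submodule_set v -> submodule_set (a *: u + v) }.

Section Submodule.
Variables (k : pzRingType) (V : lmodType k) (S : submodule V).

Definition submodule_pred : {pred V} := fun v => `[< S v >].

Fact submodule_pred_closed : submod_closed submodule_pred.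
Proof.
split=> [|a u v /asboolP Su /asboolP Sv]; apply/asboolP; first exact: submodule0.
exact: submoduleZD.
Qed.

HB.instance Definition _ :=
  GRing.isZmodClosed.Build V submodule_pred
    (GRing.submod_closedB submodule_pred_closed).
HB.instance Definition _ :=
  GRing.isSubmodClosed.Build k V submodule_pred submodule_pred_closed.

Record submod_of := SubmodOf {
  submod_val : V; submod_valP : submod_val \in submodule_pred }.

HB.instance Definition _ := [isSub for submod_val].
HB.instance Definition _ := [Choice of submod_of by <:].
HB.instance Definition _ := [SubChoice_isSubLmodule of submod_of by <:].

Fact submod_val_is_linear : linear submod_val.
Proof. exact: (@linearP _ _ _ _ (\val : submod_of -> V)). Qed.

HB.instance Definition _ :=
  GRing.isLinear.Build k submod_of V _ submod_val submod_val_is_linear.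
End Submodule.

Section ModuleQuotient.
Local Open Scope quotient_scope.
Variables (k : pzRingType) (V : lmodType k) (B : submodule V).

Definition modquot := Quotient.quot (submodule_pred B).
HB.instance Definition _ := EqQuotient.on modquot.
HB.instance Definition _ := GRing.Zmodule.on modquot.

Lemma modquot_eqP (x y : V) : \pi_modquot x = \pi_modquot y <-> B (x - y).
Proof.
split=> [/eqP|Bxy]; first by rewrite -Quotient.idealrBE => /asboolP.
by apply/eqP; rewrite -Quotient.idealrBE; apply/asboolP.
Qed.

Fact modquot_piD (x y : V) :
  \pi_modquot (x + y) = \pi_modquot x + \pi_modquot y.
Proof. by rewrite [LHS]raddfD. Qed.

Definition modquot_scale (a : k) (x : modquot) : modquot :=
  \pi_modquot (a *: repr x).

Fact modquot_piZ_subproof a (x : V) :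
  modquot_scale a (\pi_modquot x) = \pi_modquot (a *: x).
Proof.
apply/eqP; rewrite -Quotient.idealrBE -scalerBr rpredZ //.
by rewrite Quotient.idealrBE reprK.
Qed.

Fact modquot_scaleA a b x :
  modquot_scale a (modquot_scale b x) = modquot_scale (a * b) x.
Proof.
by elim/(@quotW _ modquot): x => x; rewrite !modquot_piZ_subproof scalerA.
Qed.

Fact modquot_scale1 : left_id 1 modquot_scale.
Proof. by elim/(@quotW _ modquot)=> x; rewrite modquot_piZ_subproof scale1r. Qed.

Fact modquot_scaleDr : right_distributive modquot_scale +%R.
Proof.
move=> a; elim/(@quotW _ modquot)=> x; elim/(@quotW _ modquot)=> y.
by rewrite -modquot_piD !modquot_piZ_subproof -modquot_piD scalerDr.
Qed.

Fact modquot_scaleDl x : {morph modquot_scale^~ x : a b / a + b}.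
Proof.
move=> a b; elim/(@quotW _ modquot): x => x.
by rewrite !modquot_piZ_subproof scalerDl modquot_piD.
Qed.

HB.instance Definition _ := GRing.Zmodule_isLmodule.Build k modquot
  modquot_scaleA modquot_scale1 modquot_scaleDr modquot_scaleDl.

Lemma modquot_piZ a (x : V) : \pi_modquot (a *: x) = a *: \pi_modquot x.
Proof. by rewrite -modquot_piZ_subproof. Qed.
End ModuleQuotient.

Section Subquotient.
Variables (k : pzRingType) (V : lmodType k).

Definition restrict_submodule (Z B : submodule V) : submodule (submod_of Z).
Proof.
exists (fun z => B (submod_val z)) => [|a u v Bu Bv].
  by rewrite (raddf0 (@submod_val _ _ Z)); exact: submodule0.
by rewrite (linearP (@submod_val _ _ Z)); exact: submoduleZD.
Defined.

(* Z / (Z `&` B); B is not required to be contained in Z. *)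
Definition subquotient (Z B : submodule V) : lmodType k :=
  modquot (restrict_submodule Z B).
End Subquotient.

Section SubquotientMap.
Local Open Scope quotient_scope.
Variables (k : pzRingType) (V V' : lmodType k).
Variables (Z B : submodule V) (Z' B' : submodule V') (f : {linear V -> V'}).
Hypothesis fZ : forall x, Z x -> Z' (f x).
Hypothesis fB : forall x, B x -> B' (f x).

Fact submod_map_subproof (z : submod_of Z) :
  f (submod_val z) \in submodule_pred Z'.
Proof. by apply/asboolP/fZ/asboolP/submod_valP. Qed.

Definition submod_map (z : submod_of Z) : submod_of Z' :=
  SubmodOf (submod_map_subproof z).

Definition subquotient_fun (x : subquotient Z B) : subquotient Z' B' :=
  \pi_(modquot (restrict_submodule Z' B')) (submod_map (repr x)).

Lemma subquotient_fun_pi (z : submod_of Z) :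
  subquotient_fun (\pi_(modquot (restrict_submodule Z B)) z) =
  \pi_(modquot (restrict_submodule Z' B')) (submod_map z).
Proof.
rewrite /subquotient_fun; set w := repr _.
have Bwz : B (submod_val w - submod_val z).
  rewrite -(raddfB (@submod_val _ _ Z)).
  by apply/(modquot_eqP (restrict_submodule Z B)); rewrite reprK.
apply/modquot_eqP; change (B' (submod_val (submod_map w - submod_map z))).
by rewrite (raddfB (@submod_val _ _ Z')) /= -(raddfB f); exact: fB.
Qed.

Fact subquotient_fun_is_linear : linear subquotient_fun.
Proof.
move=> a; elim/(@quotW _ (modquot (restrict_submodule Z B)))=> x.
elim/(@quotW _ (modquot (restrict_submodule Z B)))=> y.
rewrite -modquot_piZ -modquot_piD !subquotient_fun_pi -modquot_piZ -modquot_piD.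
congr (\pi_ _ _); apply: val_inj.
rewrite [RHS](@linearP _ _ _ _ (@submod_val _ _ Z')) /= -(linearP f).
by congr (f _); exact: (@linearP _ _ _ _ (@submod_val _ _ Z)).
Qed.

Definition subquotient_map : {linear subquotient Z B -> subquotient Z' B'} :=
  HB.pack subquotient_fun (GRing.isLinear.Build k (subquotient Z B)
    (subquotient Z' B') _ subquotient_fun subquotient_fun_is_linear).

Lemma subquotient_map_pi (z : submod_of Z) :
  subquotient_map (\pi_(modquot (restrict_submodule Z B)) z) =
  \pi_(modquot (restrict_submodule Z' B')) (submod_map z).
Proof. exact: subquotient_fun_pi. Qed.
End SubquotientMap.
Arguments subquotient_map {k V V' Z B Z' B'} f fZ fB.

Section Homology.
Variables (k : fieldType) (T : choiceType).
Implicit Type K : set (set T).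

(* Oriented [n.-1]-chains of [K], as finitely supported functions on the
   ordered simplices that are alternating under reorderings.  Degenerate tuples
   are excluded explicitly, which matters in characteristic 2. *)
Definition is_chain K n (c : n.-tuple T -> k^o) : Prop :=
  [/\ finite_set [set t | c t != 0],
      forall t, c t != 0 -> uniq t /\ K [set x | x \in t]
    & forall (t : n.-tuple T) (s : 'S_n),
        c [tuple tnth t (s i) | i < n] = (-1) ^+ s * c t].

(* In terms of oriented simplices this is
   [v_0, .., v_n] |-> \sum_i (-1)^i [v_0, .., v_i omitted, .., v_n]: the ordered
   facet with v_i omitted inherits the sign of moving v_i to the front. *)
Definition boundary n (c : n.+1.-tuple T -> k^o) : n.-tuple T -> k^o :=
  fun t => \sum_(v \in [set: T]) c [tuple of v :: t].

Lemma finite_supp_cons K n (c : n.+1.-tuple T -> k^o) (t : n.-tuple T) :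
  is_chain K c -> finite_set [set v | c [tuple of v :: t] != 0].
Proof.
case=> finc _ _.
apply: (sub_finite_set _ (finite_image (fun u : n.+1.-tuple T => thead u) finc)).
by move=> v /= cv; exists [tuple of v :: t].
Qed.

Lemma boundaryZD K n a (c e : n.+1.-tuple T -> k^o) :
  is_chain K c -> is_chain K e ->
  boundary (a *: c + e) = a *: boundary c + boundary e.
Proof.
move=> Kc Ke; apply/funext => t.
pose S (f : n.+1.-tuple T -> k^o) := [set v | f [tuple of v :: t] != 0].
pose P := S c `|` S e.
have restr (f : n.+1.-tuple T -> k^o) : S f `<=` P ->
    boundary f t = \sum_(v \in P) f [tuple of v :: t].
  move=> fP; apply/esym; apply: fsbig_widen => // v [_ /= NPv].
  by have [//|fv] := eqVneq (f [tuple of v :: t]) 0; case: NPv; exact: fP.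
rewrite [RHS](_ : _ = a * boundary c t + boundary e t) //.
rewrite !restr; last 3 first.
- by move=> v ?; right.
- by move=> v ?; left.
- move=> v; rewrite /S /= [X in X != _](_ : _ = a * c [tuple of v :: t] +
    e [tuple of v :: t]) // => H; apply/orP; rewrite -negb_and.
  by apply: contra H => /andP[/eqP-> /eqP->]; rewrite mulr0 addr0.
rewrite mulr_fsumr -fsbig_split //.
rewrite finite_setU.
exact: (conj (finite_supp_cons t Kc) (finite_supp_cons t Ke)).
Qed.

Lemma is_chain0 K n : is_chain K (0 : n.-tuple T -> k^o).
Proof.
split=> [|t|t s]; [|by rewrite eqxx|by rewrite mulr0].
by rewrite [X in finite_set X](_ : _ = set0) // -subset0 => t /=; rewrite eqxx.
Qed.

Lemma is_chainZD K n a (c e : n.-tuple T -> k^o) :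
  is_chain K c -> is_chain K e -> is_chain K (a *: c + e).
Proof.
move=> [finc Kc altc] [fine Ke alte].
have supp t : (a *: c + e) t != 0 -> c t != 0 \/ e t != 0.
  move=> H; apply/orP; rewrite -negb_and; apply: contra H => /andP[/eqP ct /eqP et].
  by rewrite [_ t](_ : _ = a *: c t + e t) // ct et scaler0 addr0.
split=> [|t /supp[/Kc|/Ke]//|t s].
  apply: (sub_finite_set _ (_ : finite_set ([set t | c t != 0] `|` [set t | e t != 0]))).
    exact: supp.
  by rewrite finite_setU.
rewrite [LHS](_ : _ = a * c [tuple tnth t (s i) | i < n] +
  e [tuple tnth t (s i) | i < n]) // altc alte.
by rewrite [in RHS](_ : _ t = a * c t + e t) // mulrDr mulrCA.
Qed.

Definition cycles K j : submodule (j.+1.-tuple T -> k^o).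
Proof.
exists (fun c => is_chain K c /\ ((0 < j)%N -> boundary c = 0)).
  split=> [|j0]; first exact: is_chain0.
  apply/funext => t; exact: fsbig1.
move=> a u v [Ku u0] [Kv v0]; split; first exact: is_chainZD.
by move=> j0; rewrite (boundaryZD a Ku Kv) (u0 j0) (v0 j0) scaler0 addr0.
Defined.

Definition boundaries K j : submodule (j.+1.-tuple T -> k^o).
Proof.
exists (fun b => exists2 c : j.+2.-tuple T -> k^o, is_chain K c & boundary c = b).
  exists 0; first exact: is_chain0.
  apply/funext => t; exact: fsbig1.
move=> a _ _ [u Ku <-] [v Kv <-]; exists (a *: u + v); first exact: is_chainZD.
exact: boundaryZD Ku Kv.
Defined.

Definition homology K j : lmodType k := subquotient (cycles K j) (boundaries K j).

Section Inclusion.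
Variables (K L : set (set T)) (j : nat).
Hypothesis KL : K `<=` L.

Lemma is_chain_sub n (c : n.-tuple T -> k^o) : is_chain K c -> is_chain L c.
Proof. by case=> finc Kc altc; split=> // t /Kc[ut /KL]. Qed.

Fact cycles_sub c : cycles K j c -> cycles L j (idfun c).
Proof. by case=> /is_chain_sub. Qed.

Fact boundaries_sub c : boundaries K j c -> boundaries L j (idfun c).
Proof. by case=> e /is_chain_sub; exists e. Qed.

Definition homology_incl : {linear homology K j -> homology L j} :=
  subquotient_map idfun cycles_sub boundaries_sub.
End Inclusion.

Lemma homology_incl_pi K L j (KL : K `<=` L) (z : submod_of (cycles K j)) :
  homology_incl j KL
    (\pi_(modquot (restrict_submodule (cycles K j) (boundaries K j)))%qT z) =
  \pi_(modquot (restrict_submodule (cycles L j) (boundaries L j)))%qT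
    (submod_map (@cycles_sub K L j KL) z).
Proof. exact: subquotient_map_pi. Qed.

Lemma homology_incl_id K j (KK : K `<=` K) x : homology_incl j KK x = x.
Proof.
elim/(@quotW _ (modquot (restrict_submodule (cycles K j) (boundaries K j)))): x
  => z.
by rewrite homology_incl_pi; congr (\pi_ _ _)%qT; exact: val_inj.
Qed.

Lemma homology_incl_comp K L M j (KL : K `<=` L) (LM : L `<=` M)
    (KM : K `<=` M) x :
  homology_incl j LM (homology_incl j KL x) = homology_incl j KM x.
Proof.
elim/(@quotW _ (modquot (restrict_submodule (cycles K j) (boundaries K j)))): x
  => z.
rewrite homology_incl_pi [LHS]homology_incl_pi [RHS]homology_incl_pi.
by congr (\pi_ _ _)%qT; exact: val_inj.
Qed.
End Homology.

Record pmodule (R : realType) (k : fieldType) := PModule {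
  pm_space :> {nonneg R} -> lmodType k;
  pm_map : forall r s : {nonneg R}, r <= s -> {linear pm_space r -> pm_space s};
  pm_map_id : forall r (rr : r <= r) x, pm_map rr x = x;
  pm_map_comp : forall r s t (rs : r <= s) (st : s <= t) (rt : r <= t) x,
    pm_map st (pm_map rs x) = pm_map rt x }.

Section Interleaving.
Variables (R : realType) (k : fieldType).
Implicit Types (e r s : {nonneg R}) (V W : pmodule R k).

Definition shift e r : {nonneg R} := (r%:num + e%:num)%:nng.

Definition interleaved e V W : Prop :=
  exists (phi : forall r, {linear V r -> W (shift e r)})
         (psi : forall r, {linear W r -> V (shift e r)}),
  [/\ forall r s (rs : r <= s) (rs' : shift e r <= shift e s) x,
        phi s (pm_map V rs x) = pm_map W rs' (phi r x),
      forall r s (rs : r <= s) (rs' : shift e r <= shift e s) x,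
        psi s (pm_map W rs x) = pm_map V rs' (psi r x),
      forall r (rr : r <= shift e (shift e r)) x,
        psi (shift e r) (phi r x) = pm_map V rr x
    & forall r (rr : r <= shift e (shift e r)) x,
        phi (shift e r) (psi r x) = pm_map W rr x].

Definition interleaving_distance V W : \bar R :=
  ereal_inf [set e%:num%:E | e in [set e | interleaved e V W]].
End Interleaving.

Section Cech.
Variables (R : realType) (Z : choiceType) (dist : Z -> Z -> \bar R).

Definition eball (z : Z) (r : R) : set Z := [set w | (dist z w < r%:E)%E].

Definition nerve (I : Type) (Y : set I) (B : I -> set Z) : set (set I) :=
  [set s | [/\ finite_set s, s !=set0, s `<=` Y & (\bigcap_(y in s) B y) !=set0]].

Definition cech (Y : set Z) (r : R) : set (set Z) := nerve Y (eball ^~ r).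

Lemma cech_sub Y (r s : R) : r <= s -> cech Y r `<=` cech Y s.
Proof.
move=> rs S [finS S0 SY [z Sz]]; split=> //; exists z => y Sy.
by apply: (lt_le_trans (Sz y Sy)); rewrite lee_fin.
Qed.

Section CechHomology.
Variables (k : fieldType) (Y : set Z) (j : nat).

Let H (r : {nonneg R}) : lmodType k := homology k (cech Y r%:num) j.

Let Hmap (r s : {nonneg R}) (rs : r <= s) : {linear H r -> H s} :=
  homology_incl k j (@cech_sub Y r%:num s%:num rs).

Fact cech_homology_id r (rr : r <= r) x : Hmap rr x = x.
Proof. exact: homology_incl_id. Qed.

Fact cech_homology_comp r s t (rs : r <= s) (st : s <= t) (rt : r <= t) x :
  Hmap st (Hmap rs x) = Hmap rt x.
Proof. exact: homology_incl_comp. Qed.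

Definition cech_homology : pmodule R k :=
  PModule cech_homology_id cech_homology_comp.
End CechHomology.
End Cech.

Section Smooth.
Variables (R : realType) (V W : normedModType R).

Fixpoint Ck_on (k : nat) (U : set V) (f : V -> W) : Prop :=
  match k with
  | 0 => forall x, U x -> {for x, continuous f}
  | k'.+1 => (forall x, U x -> differentiable f x) /\
             (forall v, Ck_on k' U (fun x => 'D_v f x))
  end.

Definition smooth_on (U : set V) (f : V -> W) : Prop := forall k, Ck_on k U f.
End Smooth.

(* The total functions [cfun] and [cinv] are only meaningful on [cdom] and on its
   image respectively. *)
Record chart (R : realType) (n : nat) (X : topologicalType) := Chart {
  cdom : set X;
  cfun : X -> 'rV[R]_n;
  cinv : 'rV[R]_n -> X;
  cdom_open : open cdom;
  cimg_open : open (cfun @` cdom);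
  cfunK : forall x, cdom x -> cinv (cfun x) = x;
  cfun_continuous : forall x, cdom x -> {for x, continuous cfun};
  cinv_continuous : forall x, cdom x -> {for cfun x, continuous cinv} }.

Section Manifold.
Variables (R : realType) (n : nat) (X : topologicalType).
Implicit Types (a b : chart R n X) (A : set (chart R n X)).

Definition smooth_transition a b : Prop :=
  smooth_on (cfun a @` (cdom a `&` cdom b)) (cfun b \o cinv a).

Definition smoothly_compatible a b : Prop :=
  smooth_transition a b /\ smooth_transition b a.

Definition smooth_atlas A : Prop :=
  (forall x, exists2 a, A a & cdom a x) /\
  (forall a b, A a -> A b -> smoothly_compatible a b).

Definition closed_manifold A : Prop :=
  [/\ hausdorff_space X, @second_countable X, compact [set: X] & smooth_atlas A].

Definition locally_finite_atlas A (I : Type) (phi : I -> chart R n X) : Prop :=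
  [/\ forall i a, A a -> smoothly_compatible a (phi i),
      forall x, exists i, cdom (phi i) x
    & forall x : X, exists2 U, nbhs x U &
        finite_set [set i | cdom (phi i) `&` U !=set0]].
End Manifold.

Section Euclidean.
Variables (R : realType) (n : nat).

Definition euclidean_chart : chart R n 'rV[R]_n.
Proof.
apply: (@Chart R n 'rV[R]_n [set: 'rV[R]_n] id id) => //.
- exact: openT.
- by rewrite image_id; exact: openT.
- by move=> x _; exact: cvg_id.
- by move=> x _; exact: cvg_id.
Defined.

Definition enorm (v : 'rV[R]_n) : R := Num.sqrt (\sum_i v ord0 i ^+ 2).
End Euclidean.

Section MapsToEuclidean.
Variables (R : realType) (d D : nat) (X : topologicalType).
Variable A : set (chart R d X).
Implicit Type F : X -> 'rV[R]_D.

Definition Ck_map k F : Prop :=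
  forall a, A a -> Ck_on k (cfun a @` cdom a) (F \o cinv a).

(* The rows are the images of the coordinate vector fields of the chart. *)
Definition coordinate_frame F (a : chart R d X) (x : X) : 'M[R]_(d, D) :=
  'J (F \o cinv a) (cfun a x).

Definition Ck_embedding k F : Prop :=
  [/\ Ck_map k F,
      forall a x, A a -> cdom a x -> row_free (coordinate_frame F a x),
      injective F
    & forall U, open U -> exists2 V, open V & F @` U = V `&` range F].
End MapsToEuclidean.

Section Submanifold.
Variables (R : realType) (d D : nat).
Implicit Types (N : set 'rV[R]_D) (p v : 'rV[R]_D).

Definition smooth_submanifold N : Prop :=
  forall p, N p -> exists a : chart R D 'rV[R]_D,
    [/\ smoothly_compatible (@euclidean_chart R D) a, cdom a p
      & forall q, cdom a q ->
          N q <-> forall i : 'I_D, (d <= i)%N -> cfun a q ord0 i = 0].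

Definition tangent N p : set 'rV[R]_D := [set v |
  exists (e : R) (gamma : R -> 'rV[R]_D),
    [/\ 0 < e, smooth_on (ball (0 : R^o) e) (gamma : R^o -> 'rV[R]_D),
        forall t, ball (0 : R^o) e t -> N (gamma t), gamma 0 = p
      & derive1 gamma 0 = v]].
End Submanifold.

(* An oriented [d]-dimensional subspace of R^D is the row space of [og_plane],
   with a sign attached to each of its ordered bases (given as the rows of
   [d x D] matrices), positive when [og_pos] holds.  [<<_>>%MS] being a canonical
   form, distinct elements of [ograss] are distinct oriented subspaces.  For
   d = 0 there are two of them, as the only (empty) basis may have either sign. *)
Record ograss (R : realType) (d D : nat) := OGrass {
  og_plane : 'M[R]_D;
  og_pos : 'M[R]_(d, D) -> bool;
  og_plane_canonical : og_plane = <<og_plane>>%MS;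
  og_rank : \rank og_plane = d;
  og_pos_basis : forall X, og_pos X -> (X == og_plane)%MS;
  og_pos_change : forall (X : 'M[R]_(d, D)) (B : 'M[R]_d),
    (X == og_plane)%MS -> B \in unitmx ->
    og_pos (B *m X) = og_pos X (+) (\det B < 0) }.

HB.instance Definition _ R d D := gen_eqMixin (ograss R d D).
HB.instance Definition _ R d D := gen_choiceMixin (ograss R d D).

Section OrientedGrassmannian.
Variables (R : realType) (d D : nat).
Local Notation G := (ograss R d D).
Implicit Types (P : G) (X dX : 'M[R]_(d, D)).

(* [X] is an ordered basis of the plane of [P], positive iff [b]. *)
Definition signed_basis P (b : bool) X : Prop :=
  (X == og_plane P)%MS /\ og_pos P X = b.

(* If [X] is an ordered basis of a plane P and moves with velocity [dX], then P
   moves with velocity the linear map P -> P^\perp that sends the i-th row of [X]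
   to the i-th row of [gr_velocity X dX]. *)
Definition gr_velocity X dX : 'M[R]_(d, D) :=
  dX *m (1%:M - X^T *m invmx (X *m X^T) *m X).

(* The squared Hilbert--Schmidt norm of that linear map, the Gram matrix of [X]
   accounting for [X] not being orthonormal. *)
Definition gr_sqnorm X dX : R :=
  let Y := gr_velocity X dX in \tr (invmx (X *m X^T) *m (Y *m Y^T)).

Definition egrass : Type := ('rV[R]_D * G)%type.
HB.instance Definition _ := Choice.on egrass.

Definition C1_curve (W : normedModType R) (f : R -> W) : Prop :=
  (forall t, derivable f t 1) /\ continuous (derive1 f).

(* C^1 curves in the product, [t |-> (x t, oriented row space of X t)] on
   [0, 1]. *)
Definition C1_segment (z w : egrass) (x : R -> 'rV[R]_D) (X : R -> 'M[R]_(d, D)) :=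
  [/\ C1_curve x, C1_curve X, x 0 = z.1 /\ x 1 = w.1,
      forall t, 0 <= t <= 1 -> row_free (X t)
    & exists b, signed_basis z.2 b (X 0) /\ signed_basis w.2 b (X 1)].

Variable c : R.

Definition segment_length (x : R -> 'rV[R]_D) (X : R -> 'M[R]_(d, D)) : R :=
  \int[lebesgue_measure]_(t in `[0, 1])
    Num.sqrt (enorm (derive1 x t) ^+ 2 + c * gr_sqnorm (X t) (derive1 X t)).

(* Piecewise C^1 curves: [l] is the length of a concatenation of segments. *)
Inductive joined : egrass -> egrass -> R -> Prop :=
| joined_refl z : joined z z 0
| joined_step z y w (x : R -> 'rV[R]_D) (X : R -> 'M[R]_(d, D)) l :
    C1_segment z y x X -> joined y w l ->
    joined z w (segment_length x X + l).

Definition egrass_dist (z w : egrass) : \bar R :=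
  ereal_inf [set l%:E | l in [set l | joined z w l]].
End OrientedGrassmannian.

Section Gauss.
Variables (R : realType) (d D : nat).
Implicit Types (N : set 'rV[R]_D) (g : 'rV[R]_D -> ograss R d D).

(* [g] (restricted to [N]) is the Gauss map for an orientation of [N]: it sends p
   to T_pN with an orientation, and these orientations vary continuously, that
   is, have locally continuous bases of constant sign. *)
Definition oriented_gauss_map N g : Prop :=
  (forall p v, N p -> (v <= og_plane (g p))%MS <-> tangent N p v) /\
  (forall p, N p -> exists (U : set 'rV[R]_D) (X : 'rV[R]_D -> 'M[R]_(d, D)) b,
     [/\ open U, U p, {within N `&` U, continuous X}
       & forall q, N q -> U q -> signed_basis (g q) b (X q)]).

Definition closed_oriented_submanifold N g : Prop :=
  [/\ compact N, smooth_submanifold d N & oriented_gauss_map N g].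

Definition gauss_graph N g : set (egrass R d D) := [set (p, g p) | p in N].

Definition gauss_cech_homology (c : R) (k : fieldType) N g (j : nat) :
    pmodule R k :=
  cech_homology (@egrass_dist R d D c) k (gauss_graph N g) j.
End Gauss.

Section Whitney.
Variables (R : realType) (d D : nat) (X : topologicalType).
Variable A : set (chart R d X).
Variables (F : nat -> X -> 'rV[R]_D) (Foo : X -> 'rV[R]_D).

Definition partial1 (beta : option 'I_d) (f : 'rV[R]_d -> 'rV[R]_D) :=
  if beta is Some i then fun x => 'D_(delta_mx ord0 i) f x else f.

Definition whitney_C1_cvg : Prop :=
  exists (I : Type) (phi : I -> chart R d X) (psi : I -> chart R D 'rV[R]_D),
  [/\ locally_finite_atlas A phi,
      locally_finite_atlas [set @euclidean_chart R D] psi,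
      forall a, Foo @` cdom (phi a) `<=` cdom (psi a)
    & forall a (eps : R), 0 < eps -> exists n, forall i, (n <= i)%N ->
        F i @` cdom (phi a) `<=` cdom (psi a) /\
        forall beta,
          (ereal_sup [set
             (enorm (partial1 beta (cfun (psi a) \o F i \o cinv (phi a)) x -
                     partial1 beta (cfun (psi a) \o Foo \o cinv (phi a)) x))%:E
             | x in cfun (phi a) @` cdom (phi a)] < eps%:E)%E].

(* For each i, the diffeomorphism F i \o Foo^-1 either preserves or reverses the
   orientations given by [g i] and [goo].  This is automatic when X is connected. *)
Definition compatible_orientations (g : nat -> 'rV[R]_D -> ograss R d D)
    (goo : 'rV[R]_D -> ograss R d D) : Prop :=
  forall i, exists s : bool, forall a x, A a -> cdom a x ->
    og_pos (g i (F i x)) (coordinate_frame (F i) a x) =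
    og_pos (goo (Foo x)) (coordinate_frame Foo a x) (+) s.
End Whitney.

(* Main.v *)
Require Import Defs.
From HB Require Import structures.
From mathcomp Require Import all_boot all_order all_algebra all_fingroup.
From mathcomp Require Import all_classical all_reals all_analysis.
Import Order.TTheory GRing.Theory Num.Theory.
Import numFieldNormedType.Exports.
Local Open Scope classical_set_scope.
Local Open Scope ring_scope.

(** The vertices of both filtrations are parametrized by [X], through
[x |-> (F i x, g i (F i x))] and [x |-> (Foo x, goo (Foo x))].  For large [i]
these two points of R^D x Gr^+ are joined by a curve of length less than [e],
for all [x] at once and up to one change of orientation depending only on [i].
Everything else is formal.

Formal part.  If matched vertices are [e]-close, a point common to the balls of
radius [r] around some vertices is common to the balls of radius [r + e] around
the matched ones.  As the matching is a bijection, it carries simplices to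
simplices and the two induced chain maps are mutually inverse as maps of chains,
so they form an [e]-interleaving without any chain homotopy
([cech_interleaved]).  Reversing all orientations preserves lengths of curves,
which absorbs the change of orientation ([shadow_almost_isometric]).

Short curves.  The tangent plane of [F i] at [x] is spanned by the rows of the
Jacobian of [F i] in a chart ([frame_og_plane]).  C^1 convergence makes these
frames converge, jointly in [x] and [i], to the frame of [Foo] at a given point
([whitney_frame_cvg]).  Between two frames close to a given frame [X0] the
straight segment stays among the frames, and since the speed in the Grassmannian
is a continuous function of the frame and its velocity that vanishes with the
velocity, the segment is short ([straight_segment_short]).  Compactness of [X]
then makes the estimate uniform.

Orientations.  The segment ends at the correct oriented plane if the frames of
[F i] and [Foo] have the same sign with respect to [g i] and [goo].  In a given
chart both signs are locally constant, and a change of chart multiplies both by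
the sign of the same determinant, so their quotient is a locally constant
function on [X]; it is constant when [X] is connected
([connected_frame_sign]). *)

(** * Transport of chains along a bijection of vertices *)

Section ChainTransport.
Context {k : fieldType} {T : choiceType}.
Implicit Types (Y : set T) (f h : T -> T).

(** Push-forward along a map with inverse [h] on its image [Y]; it is written
through the inverse because a chain is a function on tuples. *)
Definition push_chain Y h {n} (c : n.-tuple T -> k^o) : n.-tuple T -> k^o :=
  fun t => if all (fun v => `[< Y v >]) t then c [tuple of map h t] else 0.

Fact push_chain_is_linear Y h n : linear (@push_chain Y h n).
Proof.
move=> a u v; apply/funext => t.
rewrite [RHS](_ : _ = a *: push_chain Y h u t + push_chain Y h v t) //.
by rewrite /push_chain; case: ifP => // _; rewrite scaler0 addr0.
Qed.

HB.instance Definition _ Y h n := GRing.isLinear.Build k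
  (n.-tuple T -> k^o) (n.-tuple T -> k^o) _ (@push_chain Y h n)
  (push_chain_is_linear Y h n).

Lemma push_chain_neq0 {Y h n} {c : n.-tuple T -> k^o} {t} :
  push_chain Y h c t != 0 ->
  (forall v, v \in tval t -> Y v) /\ c [tuple of map h t] != 0.
Proof.
rewrite /push_chain; case: ifP => [/allP Yt ct|]; last by rewrite eqxx.
by split=> // v /Yt/asboolP.
Qed.

Context {Y Y' : set T} {f h : T -> T}.
Hypothesis fY : forall y, Y y -> Y' (f y).
Hypothesis hY : forall y, Y' y -> Y (h y).
Hypothesis fK : forall y, Y y -> h (f y) = y.
Hypothesis hK : forall y, Y' y -> f (h y) = y.

(** For a bijection no two vertices of a simplex are identified, so the
push-forward of an alternating function supported on nondegenerate tuples is
again one. *)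
Lemma push_chain_is_chain {K L : set (set T)} {n} {c : n.-tuple T -> k^o} :
  (forall s, K s -> L (f @` s)) ->
  is_chain K c -> is_chain L (push_chain Y' h c).
Proof.
move=> KL [finc Kc altc].
have tE (t : n.-tuple T) : (forall v, v \in tval t -> Y' v) ->
    t = [tuple of map f [tuple of map h t]].
  move=> Yt; apply: val_inj => /=; rewrite -map_comp -[LHS]map_id.
  by apply/eq_in_map => v /Yt /hK.
split.
- apply: (sub_finite_set _ (finite_image (fun t : n.-tuple T => [tuple of map f t]) finc)).
  move=> t /= /push_chain_neq0[Yt ct].
  by exists [tuple of map h t] => //; rewrite -tE.
- move=> t /push_chain_neq0[Yt /Kc[ut Kt]]; split; first exact: map_uniq ut.
  rewrite (_ : [set x | x \in tval t] = f @` [set x | x \in map h t]).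
    exact: KL.
  apply/seteqP; split=> [x xt|_ [_ /= /mapP[x xt ->] <-]] /=.
    by exists (h x); rewrite ?map_f ?hK //; exact: Yt.
  by rewrite hK //; exact: Yt.
- move=> t s; rewrite /push_chain.
  rewrite (_ : all _ [tuple tnth t (s i) | i < n] = all (fun v => `[< Y' v >]) t).
    case: ifP => _; last by rewrite mulr0.
    rewrite -altc; congr c; apply: eq_from_tnth => i.
    by rewrite !(tnth_map, tnth_ord_tuple).
  apply/all_tnthP/all_tnthP => Yt i.
    by have := Yt (s^-1%g i); rewrite !(tnth_map, tnth_ord_tuple) permKV.
  by rewrite !(tnth_map, tnth_ord_tuple).
Qed.

Lemma boundary_push_chain {K : set (set T)} {n} {c : n.+1.-tuple T -> k^o} :
  (forall s, K s -> s `<=` Y) -> is_chain K c ->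
  boundary (push_chain Y' h c) = push_chain Y' h (boundary c).
Proof.
move=> KY [_ Kc _]; apply/funext => t; rewrite /boundary /push_chain /=.
case: ifP => Yt; last by rewrite fsbig1 // => v _; rewrite andbF.
have restr (W : set T) (F : T -> k^o) : (forall v, ~ W v -> F v = 0) ->
    \sum_(v \in [set: T]) F v = \sum_(v \in W) F v.
  by move=> F0; apply/esym; apply: fsbig_widen => // v [_ /= /F0].
(* Both sums may be restricted to vertices of the complexes, where the bijection
   reindexes one into the other. *)
rewrite (restr Y'); last by move=> v /asboolPn/negbTE ->.
rewrite (restr Y); last first.
  move=> v Nv; have [//|] := eqVneq (c [tuple of v :: map h t]) 0.
  move=> /Kc[_ /KY].
  by move=> /(_ v) /=; rewrite inE eqxx /= => /(_ isT).
rewrite [RHS](@reindex_fsbig _ _ _ _ _ h Y' Y); last first.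
  split=> [v /hY //|u v /set_mem Yu /set_mem Yv /(congr1 f)|u Yu].
    by rewrite !hK.
  by exists (f u); [exact: fY|exact: fK].
apply: eq_fsbigr => v /set_mem Yv /=; rewrite asboolT //=.
by congr c; exact: val_inj.
Qed.

Lemma push_cycles {K L : set (set T)} {j c} :
  (forall s, K s -> L (f @` s)) -> (forall s, K s -> s `<=` Y) ->
  cycles k K j c -> cycles k L j (push_chain Y' h c).
Proof.
move=> KL KY [Kc c0]; split; first exact: push_chain_is_chain Kc.
move=> j0; rewrite (boundary_push_chain KY Kc) (c0 j0).
exact: (linear0 (@push_chain Y' h j)).
Qed.

Lemma push_boundaries {K L : set (set T)} {j c} :
  (forall s, K s -> L (f @` s)) -> (forall s, K s -> s `<=` Y) ->
  boundaries k K j c -> boundaries k L j (push_chain Y' h c).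
Proof.
move=> KL KY [e Ke <-]; exists (push_chain Y' h e).
  exact: push_chain_is_chain Ke.
exact: boundary_push_chain KY Ke.
Qed.

Lemma push_chainK {K : set (set T)} {n} {c : n.-tuple T -> k^o} :
  (forall s, K s -> s `<=` Y) -> is_chain K c ->
  push_chain Y f (push_chain Y' h c) = c.
Proof.
move=> KY [_ Kc _]; apply/funext => t; rewrite /push_chain.
case: ifP => [/allP Yt|/negbT/allPn[v vt /asboolP nYv]].
  rewrite ifT; last by apply/allP => _ /mapP[v /Yt/asboolP Yv ->]; apply/asboolP/fY.
  congr c; apply: val_inj; rewrite /= -map_comp -[RHS]map_id.
  by apply/eq_in_map => v /Yt/asboolP/fK.
have [//|/Kc[_ /KY]] := eqVneq (c t) 0.
by move=> /(_ v vt).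
Qed.
End ChainTransport.

(** * Interleavings of Cech filtrations *)
Section CechInterleaving.
Context {R : realType} {Z : choiceType} {dist : Z -> Z -> \bar R}.
Context {k : fieldType}.

(** The witness [w'] is allowed to differ from [w]: matched vertices only have to
be close after an isometry of the ambient space. *)
Definition almost_isometric (e : R) (Y : set Z) (f : Z -> Z) :=
  forall w, exists w', forall y r, Y y ->
    (dist y w < r%:E)%E -> (dist (f y) w' < (r + e)%:E)%E.

Lemma cech_image {e : R} {Y Y' : set Z} {f r s} :
  (forall y, Y y -> Y' (f y)) -> almost_isometric e Y f ->
  cech dist Y r s -> cech dist Y' (r + e) (f @` s).
Proof.
move=> fY fe [fins [y sy] sY [w sw]]; have [w' Hw'] := fe w.
split; first exact: finite_image.
- by exists (f y), y.
- by move=> _ [z sz <-]; apply/fY/sY.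
- by exists w' => _ [z sz <-]; apply: Hw'; [exact: sY|exact: sw].
Qed.

Lemma cech_subset (Y : set Z) r s : cech dist Y r s -> s `<=` Y.
Proof. by case. Qed.

Lemma cech_homology_pi (Y : set Z) j (r s : {nonneg R}) (rs : r <= s)
    (z : submod_of (cycles k (cech dist Y r%:num) j)) :
  pm_map (cech_homology dist k Y j) rs
    (\pi_(modquot (restrict_submodule (cycles k (cech dist Y r%:num) j)
      (boundaries k (cech dist Y r%:num) j)))%qT z) =
  \pi_(modquot (restrict_submodule (cycles k (cech dist Y s%:num) j)
      (boundaries k (cech dist Y s%:num) j)))%qT
    (submod_map (cycles_sub (cech_sub rs)) z).
Proof. exact: homology_incl_pi. Qed.

(** The triangles of an interleaving commute already for chains, by
[push_chainK]; a map of vertex sets that is not a bijection would only give them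
up to homotopy. *)
Lemma cech_interleaved {e : {nonneg R}} {Y Y' : set Z} {f h : Z -> Z} {j} :
  (forall y, Y y -> Y' (f y)) -> (forall y, Y' y -> Y (h y)) ->
  (forall y, Y y -> h (f y) = y) -> (forall y, Y' y -> f (h y) = y) ->
  almost_isometric e%:num Y f -> almost_isometric e%:num Y' h ->
  interleaved e (cech_homology dist k Y j) (cech_homology dist k Y' j).
Proof.
move=> fY hY fK hK fe he.
have KL r s : cech dist Y r s -> cech dist Y' (r + e%:num) (f @` s).
  exact: cech_image.
have LK r s : cech dist Y' r s -> cech dist Y (r + e%:num) (h @` s).
  exact: cech_image.
have pushZ (r : {nonneg R}) := fun c =>
  @push_cycles k _ _ _ _ _ fY hY fK hK _ _ j c (KL r%:num) (cech_subset Y r%:num).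
have pushB (r : {nonneg R}) := fun c =>
  @push_boundaries k _ _ _ _ _ fY hY fK hK _ _ j c (KL r%:num) (cech_subset Y r%:num).
have pullZ (r : {nonneg R}) := fun c =>
  @push_cycles k _ _ _ _ _ hY fY hK fK _ _ j c (LK r%:num) (cech_subset Y' r%:num).
have pullB (r : {nonneg R}) := fun c =>
  @push_boundaries k _ _ _ _ _ hY fY hK fK _ _ j c (LK r%:num) (cech_subset Y' r%:num).
exists (fun r => subquotient_map (@push_chain k Z Y' h j.+1) (pushZ r) (pushB r)).
exists (fun r => subquotient_map (@push_chain k Z Y f j.+1) (pullZ r) (pullB r)).
have ind (W : set Z) r (P : homology k (cech dist W r) j -> Prop) :
    (forall z, P (\pi_(modquot (restrict_submodule (cycles k (cech dist W r) j)
      (boundaries k (cech dist W r) j)))%qT z)) -> forall x, P x.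
  exact: quotW.
split=> [r s rs rs'|r s rs rs'|r rr|r rr]; elim/ind => z.
- rewrite cech_homology_pi [LHS]subquotient_map_pi.
  rewrite [X in _ = pm_map _ _ X]subquotient_map_pi.
  rewrite [RHS]cech_homology_pi.
  by congr (\pi_ _ _)%qT; exact: val_inj.
- rewrite cech_homology_pi [LHS]subquotient_map_pi.
  rewrite [X in _ = pm_map _ _ X]subquotient_map_pi.
  rewrite [RHS]cech_homology_pi.
  by congr (\pi_ _ _)%qT; exact: val_inj.
- rewrite [X in subquotient_map _ _ _ X = _]subquotient_map_pi.
  rewrite [LHS]subquotient_map_pi [RHS]cech_homology_pi.
  congr (\pi_ _ _)%qT; apply: val_inj.
  have /asboolP[Kz _] := submod_valP z.
  exact: (push_chainK fY fK (cech_subset Y r%:num) Kz).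
- rewrite [X in subquotient_map _ _ _ X = _]subquotient_map_pi.
  rewrite [LHS]subquotient_map_pi [RHS]cech_homology_pi.
  congr (\pi_ _ _)%qT; apply: val_inj.
  have /asboolP[Kz _] := submod_valP z.
  exact: (push_chainK hY hK (cech_subset Y' r%:num) Kz).
Qed.
End CechInterleaving.

(** * Paths of oriented planes and reversal of orientation *)
Section OrientedGrassmannianPaths.
Context {R : realType} {d D : nat}.
Implicit Types (P : ograss R d D) (X : 'M[R]_(d, D)) (z w y : egrass R d D).

Fact reverse_basis P X :
  (X == og_plane P)%MS && ~~ og_pos P X -> (X == og_plane P)%MS.
Proof. by case/andP. Qed.

Fact reverse_change P X (B : 'M[R]_d) :
  (X == og_plane P)%MS -> B \in unitmx ->
  (B *m X == og_plane P)%MS && ~~ og_pos P (B *m X) =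
  ((X == og_plane P)%MS && ~~ og_pos P X) (+) (\det B < 0).
Proof.
move=> XP Bu; have BX : (B *m X == og_plane P)%MS.
  by apply/eqmxP; apply: eqmx_trans (eqmxMfull _ _) (eqmxP XP); rewrite row_full_unit.
by rewrite BX XP /= og_pos_change // addNb.
Qed.

Definition reverse P : ograss R d D :=
  OGrass (og_plane_canonical P) (og_rank P) (reverse_basis P) (reverse_change P).

Definition reverse_if (s : bool) P := if s then reverse P else P.

Lemma signed_basis_reverse_if {s P b X} :
  signed_basis (reverse_if s P) b X <-> signed_basis P (b (+) s) X.
Proof.
case: s; rewrite /signed_basis ?addbF //= addbT.
split=> -[XP]; rewrite XP /= => H; split=> //; last by rewrite H negbK.
by rewrite -H negbK.
Qed.

Variable c : R.

Lemma joined_trans {z y w l l'} :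
  joined c z y l -> joined c y w l' -> joined c z w (l + l').
Proof.
elim=> [?|z1 y1 w1 x X l1 zy _ IH] yw; first by rewrite add0r.
by rewrite -addrA; apply: joined_step zy (IH yw).
Qed.

Definition reverse_point s z : egrass R d D := (z.1, reverse_if s z.2).

Lemma joined_reverse s {z w l} :
  joined c z w l -> joined c (reverse_point s z) (reverse_point s w) l.
Proof.
elim=> [?|{}z y {}w x X l1 [C1x C1X xE Xf [b [zX yX]]] _ IH].
  exact: joined_refl.
apply: joined_step IH; split=> //; exists (b (+) s).
by split; apply/signed_basis_reverse_if; rewrite addbK.
Qed.

(** A path is required instead of a bound on [egrass_dist c] because the triangle
inequality then is concatenation. *)
Definition reversal_close s e z w : Prop :=
  exists2 l, l < e & joined c z (reverse_point s w) l.

(** Concatenate a short path from [f z] to the reversal of [z] with the reversal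
of a path from [z] to [w]. *)
Lemma shadow_almost_isometric {s e} {Y : set (egrass R d D)} {f} :
  (forall z, Y z -> reversal_close s e (f z) z) ->
  almost_isometric (dist := egrass_dist c) e Y f.
Proof.
move=> fe w; exists (reverse_point s w) => z r Yz /ereal_inf_lt[_ [l zw <-]].
rewrite lte_fin => lr; have [l' l'e fz] := fe z Yz.
apply: (@le_lt_trans _ _ (l' + l)%:E); last by rewrite lte_fin addrC ltrD.
apply: ereal_inf_lbound; exists (l' + l) => //.
exact: joined_trans fz (joined_reverse s zw).
Qed.

End OrientedGrassmannianPaths.

(** * Limits of matrix operations *)
Section MatrixLimits.
Context {R : realType} {T : Type} {F : set_system T} {FF : Filter F}.

Lemma cvg_mxP {m n} {f : T -> 'M[R]_(m, n)} {A : 'M[R]_(m, n)} :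
  f @ F --> A <-> forall i j, f x i j @[x --> F] --> A i j.
Proof.
split=> [fA i j|fA S [P AP PS]].
  exact: (cvg_comp _ _ fA (@coord_continuous _ _ _ i j A)).
suff : \forall x \near F, forall i j, P i j (f x i j).
  by apply: filterS => x; exact: PS.
by apply: filter_forall => i; apply: filter_forall => j; exact: fA (AP i j).
Qed.

Lemma cvg_big_sum {I : Type} {r : seq I} {f : T -> I -> R} {a : I -> R} :
  (forall i, f x i @[x --> F] --> a i) ->
  \sum_(i <- r) f x i @[x --> F] --> \sum_(i <- r) a i.
Proof.
move=> fa; elim: r => [|i r IH].
  by under eq_fun do rewrite big_nil; rewrite big_nil; exact: cvg_cst.
by under eq_fun do rewrite big_cons; rewrite big_cons; exact: cvgD.
Qed.

Lemma cvg_big_prod {I : Type} {r : seq I} {f : T -> I -> R} {a : I -> R} :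
  (forall i, f x i @[x --> F] --> a i) ->
  \prod_(i <- r) f x i @[x --> F] --> \prod_(i <- r) a i.
Proof.
move=> fa; elim: r => [|i r IH].
  by under eq_fun do rewrite big_nil; rewrite big_nil; exact: cvg_cst.
by under eq_fun do rewrite big_cons; rewrite big_cons; exact: cvgM.
Qed.

Lemma cvg_mulmx {m n p} {f : T -> 'M[R]_(m, n)} {g : T -> 'M[R]_(n, p)}
    {A : 'M[R]_(m, n)} {B : 'M[R]_(n, p)} :
  f @ F --> A -> g @ F --> B -> f x *m g x @[x --> F] --> A *m B.
Proof.
move=> /cvg_mxP fA /cvg_mxP gB; apply/cvg_mxP => i j.
under eq_fun do rewrite mxE; rewrite mxE.
by apply: cvg_big_sum => l; apply: cvgM.
Qed.

Lemma cvg_trmx {m n} {f : T -> 'M[R]_(m, n)} {A : 'M[R]_(m, n)} :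
  f @ F --> A -> (f x)^T @[x --> F] --> A^T.
Proof.
move=> /cvg_mxP fA; apply/cvg_mxP => i j.
by under eq_fun do rewrite mxE; rewrite mxE; exact: fA.
Qed.

Lemma cvg_det {n} {f : T -> 'M[R]_n} {A : 'M[R]_n} :
  f @ F --> A -> \det (f x) @[x --> F] --> \det A.
Proof.
move=> /cvg_mxP fA; apply: cvg_big_sum => s; apply: cvgM; first exact: cvg_cst.
exact: cvg_big_prod.
Qed.

Lemma cvg_adj {n} {f : T -> 'M[R]_n} {A : 'M[R]_n} :
  f @ F --> A -> \adj (f x) @[x --> F] --> \adj A.
Proof.
move=> /cvg_mxP fA; apply/cvg_mxP => i j.
under eq_fun do rewrite mxE; rewrite mxE; apply: cvgM; first exact: cvg_cst.
apply: cvg_det; apply/cvg_mxP => k l.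
by under eq_fun do rewrite !mxE; rewrite !mxE; exact: fA.
Qed.

Lemma cvg_tr {n} {f : T -> 'M[R]_n} {A : 'M[R]_n} :
  f @ F --> A -> \tr (f x) @[x --> F] --> \tr A.
Proof. by move=> /cvg_mxP fA; apply: cvg_big_sum. Qed.

Lemma near_unitmx {n} {f : T -> 'M[R]_n} {A : 'M[R]_n} :
  f @ F --> A -> A \in unitmx -> \forall x \near F, f x \in unitmx.
Proof.
move=> /cvg_det fA; rewrite unitmxE unitfE => /(cvgr_neq0 _ fA).
by apply: filterS => x; rewrite unitmxE unitfE.
Qed.

Lemma cvg_invmx {n} {f : T -> 'M[R]_n} {A : 'M[R]_n} :
  f @ F --> A -> A \in unitmx -> invmx (f x) @[x --> F] --> invmx A.
Proof.
move=> fA Au; have fu := near_unitmx fA Au.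
apply: cvg_trans (near_eq_cvg (f := fun x => (\det (f x))^-1 *: \adj (f x)) _) _.
  by apply: filterS fu => x xu; rewrite /invmx xu.
rewrite /invmx Au; apply: cvgZ; last exact: cvg_adj.
by apply: cvgV; [rewrite -unitfE -unitmxE|exact: cvg_det].
Qed.
End MatrixLimits.

(** * Straight segments between nearby frames *)
Section ShortSegments.
Context {R : realType}.

(** Over the reals the Gram form is anisotropic: v X X^T = 0 gives
|v X|^2 = v X X^T v^T = 0. *)
Lemma row_free_gram m n (X : 'M[R]_(m, n)) :
  row_free X = (X *m X^T \in unitmx).
Proof.
rewrite -row_free_unit; apply/idP/idP => Xf; apply: inj_row_free => v vX.
  apply/eqP; rewrite -(mulmx_free_eq0 _ Xf); apply/eqP/rowP => i; rewrite [RHS]mxE.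
  have /eqP : \sum_j (v *m X) 0 j ^+ 2 = 0.
    have : (v *m X *m (v *m X)^T) 0 0 = 0.
      by rewrite trmx_mul mulmxA -(mulmxA v) vX mul0mx mxE.
    rewrite mxE => vv; rewrite -[RHS]vv; apply: eq_bigr => j _.
    by rewrite [_^T _ _]mxE expr2.
  rewrite psumr_eq0 => [/allP/(_ i (mem_index_enum i))|j _]; last exact: sqr_ge0.
  by rewrite /= sqrf_eq0 => /eqP.
by apply/eqP; rewrite -(mulmx_free_eq0 _ Xf) mulmxA vX mul0mx.
Qed.

Context {d D : nat} (c : R).
Implicit Types (X dX : 'M[R]_(d, D)) (v : 'rV[R]_D).

(** The integrand of [segment_length]. *)
Definition product_speed v X dX : R :=
  Num.sqrt (enorm v ^+ 2 + c * gr_sqnorm X dX).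

Lemma product_speed0 X : product_speed 0 X 0 = 0.
Proof.
rewrite /product_speed /gr_sqnorm /gr_velocity !mul0mx mulmx0 mxtrace0 mulr0.
rewrite /enorm big1 ?sqrtr0 ?expr0n ?addr0 ?sqrtr0 // => i _.
by rewrite mxE expr0n.
Qed.

Section Limits.
Context {T : Type} {F : set_system T} {FF : Filter F}.

Lemma cvg_sqrt (f : T -> R) (a : R) :
  f @ F --> a -> Num.sqrt (f x) @[x --> F] --> Num.sqrt a.
Proof. by move=> fa; exact: (cvg_comp _ _ fa (@sqrt_continuous R a)). Qed.

Lemma near_row_free {f : T -> 'M[R]_(d, D)} {X} :
  f @ F --> X -> row_free X -> \forall x \near F, row_free (f x).
Proof.
move=> fX; rewrite row_free_gram => Xf.
near=> x; rewrite row_free_gram; near: x.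
exact: near_unitmx (cvg_mulmx fX (cvg_trmx fX)) Xf.
Unshelve. all: by end_near. Qed.

Lemma cvg_product_speed {u : T -> 'rV[R]_D} {f g : T -> 'M[R]_(d, D)} {v X dX} :
  u @ F --> v -> f @ F --> X -> g @ F --> dX -> row_free X ->
  product_speed (u x) (f x) (g x) @[x --> F] --> product_speed v X dX.
Proof.
move=> uv fX gdX; rewrite row_free_gram => Xf.
have XT : (f x)^T @[x --> F] --> X^T by exact: cvg_trmx.
have G : invmx (f x *m (f x)^T) @[x --> F] --> invmx (X *m X^T).
  exact: cvg_invmx (cvg_mulmx fX XT) Xf.
have vel : gr_velocity (f x) (g x) @[x --> F] --> gr_velocity X dX.
  apply: cvg_mulmx => //; apply: cvgB; first exact: cvg_cst.
  exact: cvg_mulmx (cvg_mulmx XT G) fX.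
apply: cvg_sqrt.
apply: cvgD; last first.
  apply: cvgM; first exact: cvg_cst.
  by apply: cvg_tr; apply: cvg_mulmx => //; apply: cvg_mulmx => //; exact: cvg_trmx.
under eq_fun do rewrite expr2; rewrite expr2.
have en : enorm (u x) @[x --> F] --> enorm v.
  apply: cvg_sqrt.
  apply: cvg_big_sum => i; under eq_fun do rewrite expr2; rewrite expr2.
  by apply: cvgM; move/cvg_mxP: uv; exact.
exact: cvgM.
Qed.
End Limits.

Definition line {W : normedModType R} (a b : W) (t : R) : W := a + t *: (b - a).

Lemma is_diff_line {W : normedModType R} (a b : W) (t : R) :
  is_diff (t : R^o) (line a b : R^o -> W) ( *:%R ^~ (b - a)).
Proof.
apply: (@is_diff_eq _ _ _ _ (0 + ( *:%R ^~ (b - a)))); first by rewrite add0r.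
Qed.

Lemma derive1_line {W : normedModType R} (a b : W) t :
  derive1 (line a b) t = b - a.
Proof.
have H := is_diff_line a b t.
by rewrite derive1E' // diff_val scale1r.
Qed.

Lemma C1_line {W : normedModType R} (a b : W) : C1_curve (line a b).
Proof.
split=> [t|].
  by have H := is_diff_line a b t; apply: diff_derivable.
rewrite (_ : derive1 _ = cst (b - a)); first exact: cst_continuous.
by apply/funext => t; rewrite derive1_line.
Qed.

Lemma continuous_line {W : normedModType R} (a b : W) (t : R) :
  line a b @ t --> line a b t.
Proof.
have H := is_diff_line a b t.
exact: (@differentiable_continuous _ R^o).
Qed.

Lemma line_ball {W : normedModType R} (o a b : W) (e t : R) :
  0 <= t <= 1 -> `|o - a| < e -> `|o - b| < e -> `|o - line a b t| < e.
Proof.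
move=> /andP[t0 t1] ae be.
have -> : o - line a b t = (1 - t) *: (o - a) + t *: (o - b).
  rewrite /line scalerBl scale1r -addrA [- (_ *: _) + _]addrC -scalerBr opprB.
  by rewrite [X in _ = _ + _ *: X]addrC subrKA opprD addrA -scalerN opprB.
apply: (le_lt_trans (ler_normD _ _)); rewrite !normrZ !ger0_norm ?subr_ge0 //.
have [->|tn0] := eqVneq t 0; first by rewrite subr0 mul1r mul0r addr0.
have -> : e = (1 - t) * e + t * e by rewrite -mulrDl subrK mul1r.
apply: ler_ltD; first by rewrite ler_wpM2l ?subr_ge0 // ltW.
by rewrite ltr_pM2l // lt_neqAle eq_sym tn0.
Qed.

(** The speed is continuous where the frame is free and vanishes at zero velocity
([product_speed0]), so it is below [e / 2] for frames near [X0] and small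
velocities.  The segment from [X1] to [X2] stays in a ball around [X0] by
convexity and has the constant velocity [X2 - X1], which is small. *)
Lemma straight_segment_short X0 (e : R) : row_free X0 -> 0 < e ->
  exists2 r : R, 0 < r & forall (z w : egrass R d D) (b : bool) X1 X2,
    `|z.1 - w.1| < r -> `|X0 - X1| < r -> `|X0 - X2| < r ->
    signed_basis z.2 b X1 -> signed_basis w.2 b X2 ->
    exists2 l, l < e & joined c z w l.
Proof.
move=> X0f e0.
pose F := nbhs ((0 : 'rV[R]_D, 0 : 'M[R]_(d, D)), X0).
have e20 : 0 < e / 2 by rewrite divr_gt0.
have : \forall q \near F, row_free q.2 /\ product_speed q.1.1 q.2 q.1.2 < e / 2.
  have c2 : q.2 @[q --> F] --> X0 by exact: cvg_snd.
  have c1 : q.1 @[q --> F] --> (0 : 'rV[R]_D, 0 : 'M[R]_(d, D)) by exact: cvg_fst.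
  have c11 : q.1.1 @[q --> F] --> (0 : 'rV[R]_D) by exact: cvg_comp c1 cvg_fst.
  have c12 : q.1.2 @[q --> F] --> (0 : 'M[R]_(d, D)) by exact: cvg_comp c1 cvg_snd.
  have sp : product_speed q.1.1 q.2 q.1.2 @[q --> F] --> 0.
    by rewrite -(product_speed0 X0); exact: cvg_product_speed.
  near=> q; split; near: q; first exact: (near_row_free c2 X0f).
  exact: cvgr_lt sp _ e20.
(* Half the radius, because the velocity [X2 - X1] is a sum of two deviations
   from [X0]. *)
move=> /nbhs_ballP[r /= r0 Hr]; exists (r / 2); first by rewrite divr_gt0.
move=> z w b X1 X2 zw zX wX zb wb.
have Ht (t : R) : 0 <= t <= 1 -> row_free (line X1 X2 t) /\
    product_speed (w.1 - z.1) (line X1 X2 t) (X2 - X1) < e / 2.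
  move=> t01; apply: (Hr (((w.1 - z.1), (X2 - X1)), line X1 X2 t)).
  split=> /=; first split=> /=.
  - rewrite -ball_normE /= sub0r normrN distrC.
    by apply: lt_trans zw _; rewrite gtr_pMr // invf_lt1 // ltr1n.
  - rewrite -ball_normE /= sub0r normrN -(subrKA X0) (splitr r) addrC.
    by rewrite (le_lt_trans (ler_normD _ _)) // ltrD // distrC.
  - rewrite -ball_normE /=; apply: lt_trans (line_ball _ _ _ _ _ t01 zX wX) _.
    by rewrite gtr_pMr // invf_lt1 // ltr1n.
exists (segment_length c (line z.1 w.1) (line X1 X2) + 0).
  rewrite addr0; apply: (@le_lt_trans _ _ (e / 2)); last first.
    by rewrite ltr_pdivrMr // ltr_pMr // ltr1n.
  have -> : segment_length c (line z.1 w.1) (line X1 X2) =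
      \int[lebesgue_measure]_(t in `[0, 1])
        product_speed (w.1 - z.1) (line X1 X2 t) (X2 - X1).
    by apply: eq_Rintegral => t _; rewrite !derive1_line.
  have I01 (f : R -> R) : {in `[0, 1], forall t : R, f @ t --> f t} ->
      (@lebesgue_measure R).-integrable `[0, 1] (EFin \o f).
    move=> cf; apply: continuous_compact_integrable; first exact: segment_compact.
    by apply/continuous_in_subspaceT => t /set_mem; exact: cf.
  have -> : e / 2 = \int[lebesgue_measure]_(t in `[0, 1]) (e / 2).
    by rewrite Rintegral_cst //= lebesgue_measure_itv /= lte01 oppr0 adde0 mulr1.
  apply: le_Rintegral => //.
  - apply: I01 => t t01; apply: cvg_product_speed; [exact: cvg_cst| |exact: cvg_cst|].
      exact: continuous_line.
    by have [] := Ht t t01.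
  - by apply: I01 => t _; exact: cvg_cst.
  - by move=> t t01; apply: ltW; have [] := Ht t t01.
apply: joined_step (joined_refl _ _); split.
- exact: C1_line.
- exact: C1_line.
- by rewrite /line scale0r addr0 scale1r addrC subrK.
- by move=> t /Ht[].
- by exists b; rewrite /line scale0r addr0 scale1r addrC subrK.
Unshelve. all: by end_near. Qed.
End ShortSegments.

(** * Differentiability near a point *)
Section LocalDifferentiability.
Context {R : realType} {V W : normedModType R}.

Lemma near_eq_differentiable {f g : V -> W} {x : V} :
  (\near x, f x = g x) -> differentiable f x ->
  differentiable g x /\ 'd g x = 'd f x :> (V -> W).
Proof.
move=> fg df; have dc := diff_continuous df.
have E : g \o shift x = cst (g x) + 'd f x +o_ (0 : V) id.
  apply/eqaddoP => e e0.
  have /eqaddoP/(_ e e0) := diff_locally df.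
  have fg0 : \forall h \near (0 : V), f (h + x) = g (h + x).
    by move: fg; rewrite (near_shift 0); apply: filterS => h; rewrite /= subr0.
  apply: filterS2 fg0 => h fgh; rewrite !fctE /=.
  by rewrite fgh (nbhs_singleton fg).
have dg := diff_unique dc E.
by split=> //; apply/diff_locallyP; rewrite dg.
Qed.

Lemma Ck_on_sub k (U U' : set V) (f : V -> W) :
  U' `<=` U -> Ck_on k U f -> Ck_on k U' f.
Proof.
elim: k f => [|k IH] f UU' /=; first by move=> fU x /UU'; exact: fU.
by move=> [df Df]; split=> [x /UU'/df //|v]; exact: IH (Df v).
Qed.

Lemma Ck_on_ext k (U : set V) (f g : V -> W) :
  open U -> (forall x, U x -> f x = g x) -> Ck_on k U f -> Ck_on k U g.
Proof.
move=> oU; elim: k f g => [|k IH] f g fg /=.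
  move=> fc x Ux; have Ufg : \near x, f x = g x.
    by apply: filterS (open_nbhs_nbhs (conj oU Ux)).
  rewrite /prop_for /continuous_at -(fg x Ux); apply: cvg_trans (fc x Ux).
  exact: near_eq_cvg.
have nfg x : U x -> \near x, f x = g x.
  by move=> Ux; apply: filterS (open_nbhs_nbhs (conj oU Ux)).
move=> [df Df]; split=> [x Ux|v].
  by have [] := near_eq_differentiable (nfg x Ux) (df x Ux).
apply: IH (Df v) => x Ux; exact: near_eq_derive (nfg x Ux).
Qed.

End LocalDifferentiability.

(** The derivative of [t |-> f (p + t *: w)] in direction [v] is
['D_(v *: w) f] along the same line, so the claim for the derivatives is an
instance of the induction hypothesis. *)
Lemma Ck_on_line {R : realType} {V W : normedModType R} k (U : set V) (f : V -> W)
    (p w : V) (U' : set R^o) :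
  open U' -> (forall t : R, U' t -> U (p + t *: w)) ->
  Ck_on k U f -> Ck_on k U' (fun t : R^o => f (p + t *: w)).
Proof.
move=> oU' UU'; have dl (t : R^o) : is_diff t (fun t : R^o => p + t *: w) ( *:%R ^~ w).
  apply: (@is_diff_eq _ _ _ _ (0 + ( *:%R ^~ w))); first by rewrite add0r.
elim: k f => [|k IH] f /=.
  move=> fU t /UU'/fU fc; apply: (@continuous_comp _ _ _ (fun t : R^o => p + t *: w) f).
    exact: differentiable_continuous.
  exact: fc.
move=> [df Df]; split=> [t /UU'/df dft|v].
  exact: (@differentiable_comp _ _ _ _ (fun t : R^o => p + t *: w) f).
apply: Ck_on_ext (IH _ (Df (v *: w))) => // t /UU'/df dft.
rewrite [RHS]deriveE; last exact: (@differentiable_comp _ _ _ _ (fun t : R^o => p + t *: w) f).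
rewrite (@diff_comp _ _ _ _ (fun t : R^o => p + t *: w) f) //= deriveE //.
by rewrite diff_val.
Qed.

Lemma derive1_along {R : realType} {V W : normedModType R} (f : V -> W) p w :
  derive1 (fun t : R => f (p + t *: w)) 0 = 'D_w f p.
Proof.
rewrite /derive1 /derive; set q1 := (fun h : R => _); set q2 := (fun h : R => _).
suff -> : q1 = q2 by [].
by apply/funext => h; rewrite /q1 /q2 /= scale0r !addr0 [p + _]addrC.
Qed.

Section C1At.
Context {R : realType}.

(** Differentiability is required around [u] since composing two such maps needs
the chain rule at points near [u]. *)
Definition C1_at {m n} (f : 'rV[R]_m -> 'rV[R]_n) (u : 'rV[R]_m) : Prop :=
  (\forall v \near u, differentiable f v) /\ {for u, continuous (jacobian f)}.

Lemma C1_at_differentiable {m n} {f : 'rV[R]_m -> 'rV[R]_n} {u : 'rV[R]_m} :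
  C1_at f u -> differentiable f u.
Proof. by case=> /nbhs_singleton. Qed.

Lemma jacobian_derive {m n} {f : 'rV[R]_m -> 'rV[R]_n} {u : 'rV[R]_m} i :
  differentiable f u -> row i ('J f u) = 'D_(delta_mx ord0 i) f u.
Proof. by move=> df; rewrite deriveEjacobian // -rowE. Qed.

Lemma Ck_on_C1_at {m n} {U : set 'rV[R]_m} {f : 'rV[R]_m -> 'rV[R]_n} {u : 'rV[R]_m} :
  open U -> U u -> Ck_on 1 U f -> C1_at f u.
Proof.
move=> oU Uu [df Df]; have nU : nbhs u U by exact: open_nbhs_nbhs.
split; first exact: filterS nU.
rewrite /prop_for /continuous_at; apply/(@cvg_mxP _ _ (nbhs u) _) => i j.
have /(@cvg_mxP _ _ (nbhs u) _)/(_ ord0 j) := Df (delta_mx ord0 i) u Uu.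
rewrite -jacobian_derive; last exact: df.
rewrite mxE => H; apply: cvg_trans H; apply: near_eq_cvg.
by apply: filterS nU => v Uv /=; rewrite -jacobian_derive ?mxE //; exact: df.
Qed.

Lemma C1_at_near {m n} {f g : 'rV[R]_m -> 'rV[R]_n} {u : 'rV[R]_m} :
  (\near u, f u = g u) -> C1_at f u -> C1_at g u /\ 'J g u = 'J f u.
Proof.
move=> fg [df Jf]; have nfg := near_join fg.
have E : \forall v \near u, differentiable g v /\ 'J g v = 'J f v.
  apply: filterS2 df nfg => v dfv fgv.
  have dg : differentiable g v by have [] := near_eq_differentiable fgv dfv.
  split; first exact: dg.
  apply/row_matrixP => i.
  apply: etrans (jacobian_derive i dg) (etrans _ (esym (jacobian_derive i dfv))).
  exact/esym/near_eq_derive.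
split; last by have [] := nbhs_singleton E.
split; first by apply: filterS E => v [].
have [_ Eu] := nbhs_singleton E.
have nJ : {near u, jacobian f =1 jacobian g}.
  by apply: filterS E => v [_ JE]; exact: esym.
have H : jacobian g @ u --> 'J f u by exact: cvg_trans (near_eq_cvg nJ) Jf.
exact: (eq_ind_r (fun M => jacobian g @ u --> M) H Eu).
Qed.

Lemma jacobian_comp {m n p} {f : 'rV[R]_m -> 'rV[R]_n} {g : 'rV[R]_n -> 'rV[R]_p} {u : 'rV[R]_m} {w} :
  f u = w -> differentiable f u -> differentiable g w ->
  'J (g \o f) u = 'J f u *m 'J g w.
Proof.
move=> <- df dg; have dgf := differentiable_comp df dg.
apply/row_matrixP => i; rewrite row_mul jacobian_derive // deriveE //.
by rewrite diff_comp //= -!deriveE // deriveEjacobian // -jacobian_derive.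
Qed.

Lemma C1_at_comp {m n p} {f : 'rV[R]_m -> 'rV[R]_n} {g : 'rV[R]_n -> 'rV[R]_p} {u : 'rV[R]_m} {w} :
  f u = w -> C1_at f u -> C1_at g w -> C1_at (g \o f) u.
Proof.
move=> <- [df Jf] [dg Jg].
have fc : f @ u --> f u by apply: differentiable_continuous; exact: nbhs_singleton df.
have dgf : \forall v \near u, differentiable g (f v) by exact: fc dg.
split; first by apply: filterS2 df dgf => v; exact: differentiable_comp.
rewrite /prop_for /continuous_at (jacobian_comp (erefl _)); last 2 first.
- exact: nbhs_singleton df.
- exact: nbhs_singleton dg.
have E : 'J f v *m 'J g (f v) @[v --> u] --> 'J f u *m 'J g (f u).
  by apply: (cvg_mulmx (F := nbhs u)); [exact: Jf|exact: cvg_comp fc Jg].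
have nJ : {near u, (fun v => 'J f v *m 'J g (f v)) =1 jacobian (g \o f)}.
  by apply: filterS2 df dgf => v dfv dgv /=; rewrite (jacobian_comp (erefl _)).
exact: cvg_trans (near_eq_cvg nJ) E.
Qed.

Lemma jacobian_id {n} (u : 'rV[R]_n) : 'J id u = 1%:M.
Proof.
apply/row_matrixP => i; rewrite jacobian_derive // derive_id.
by rewrite row1.
Qed.
End C1At.

(** * Charts and coordinate frames *)
Section Charts.
Context {R : realType} {n : nat} {X : topologicalType}.
Implicit Types a b : chart R n X.

Lemma near_cdom {a x} : cdom a x -> \forall y \near x, cdom a y.
Proof. by move=> ax; apply: open_nbhs_nbhs; split=> //; exact: cdom_open. Qed.

Lemma near_cimg {a x} : cdom a x ->
  \forall u \near cfun a x, (cfun a @` cdom a) u.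
Proof.
move=> ax; apply: open_nbhs_nbhs; split; first exact: cimg_open.
by exists x.
Qed.

Lemma near_cinv {a x} {P : set X} : cdom a x -> nbhs x P ->
  \forall u \near cfun a x, P (cinv a u).
Proof.
move=> ax xP; have := cinv_continuous ax.
by rewrite /prop_for /continuous_at cfunK // => /(_ P xP).
Qed.

Lemma near_cinvK {a x} : cdom a x -> \forall u \near cfun a x, cfun a (cinv a u) = u.
Proof.
move=> ax; near=> u.
have [y ay <-] : (cfun a @` cdom a) u by near: u; exact: near_cimg.
by rewrite cfunK.
Unshelve. all: by end_near. Qed.

Lemma transition_C1 {a b x} : smooth_transition a b -> cdom a x -> cdom b x ->
  C1_at (cfun b \o cinv a) (cfun a x).
Proof.
move=> ab ax bx; pose U := cfun a @` (cdom a `&` cdom b).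
suff nU : nbhs (cfun a x) U.
  apply: (Ck_on_C1_at (@open_interior _ U)) => //.
  exact: Ck_on_sub (@interior_subset _ U) (ab 1%N).
have H1 := near_cinv ax (near_cdom ax); have H2 := near_cinv ax (near_cdom bx).
near=> u; exists (cinv a u); last by near: u; exact: near_cinvK.
by split; near: u.
Unshelve. all: by end_near. Qed.
End Charts.

Section Frames.
Context {R : realType} {d D : nat} {X : topologicalType}.
Context {A : set (chart R d X)} {F : X -> 'rV[R]_D}.
Implicit Types a b : chart R d X.

(** The chain rule for F o b^-1 = (F o a^-1) o (a o b^-1); the matrix of the
change of frame is the same for all [F]. *)
Lemma C1_frame_change {a b x} : smoothly_compatible a b ->
  cdom a x -> cdom b x -> C1_at (F \o cinv a) (cfun a x) ->
  C1_at (F \o cinv b) (cfun b x) /\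
  coordinate_frame F b x = coordinate_frame (cfun a) b x *m coordinate_frame F a x.
Proof.
move=> [ab ba] ax bx Fa.
have T := transition_C1 ba bx ax.
have Ex : (cfun a \o cinv b) (cfun b x) = cfun a x by rewrite /= cfunK.
have E : \forall u \near cfun b x,
    ((F \o cinv a) \o (cfun a \o cinv b)) u = (F \o cinv b) u.
  by apply: filterS (near_cinv bx (near_cdom ax)) => u au /=; rewrite cfunK.
have [C JE] := C1_at_near E (C1_at_comp Ex T Fa).
split; first exact: C.
apply: etrans JE (jacobian_comp Ex _ _); exact: C1_at_differentiable.
Qed.

Lemma cvg_frame {a x} : cdom a x -> C1_at (F \o cinv a) (cfun a x) ->
  coordinate_frame F a y @[y --> x] --> coordinate_frame F a x.
Proof. by move=> ax [_ JF]; exact: cvg_comp (cfun_continuous ax) JF. Qed.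

Lemma C1_chart_continuous {a x} : cdom a x -> C1_at (F \o cinv a) (cfun a x) ->
  F y @[y --> x] --> F x.
Proof.
move=> ax Fa; have Fc := differentiable_continuous (C1_at_differentiable Fa).
have H : (F \o cinv a) (cfun a y) @[y --> x] --> (F \o cinv a) (cfun a x).
  exact: cvg_comp (cfun_continuous ax) Fc.
have nF : {near x, (fun y => (F \o cinv a) (cfun a y)) =1 F}.
  by apply: filterS (near_cdom ax) => y ay /=; rewrite cfunK.
have Ex : (F \o cinv a) (cfun a x) = F x by rewrite /= cfunK.
exact: eq_ind _ (fun p => F y @[y --> x] --> p) (cvg_trans (near_eq_cvg nF) H) _ Ex.
Qed.

Lemma Ck_map_C1_at {a x} : Ck_map A 1 F -> A a -> cdom a x ->
  C1_at (F \o cinv a) (cfun a x).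
Proof.
move=> FA Aa ax; have ux : (cfun a @` cdom a) (cfun a x) by exists x.
exact: (Ck_on_C1_at (@cimg_open _ _ _ a) ux (FA a Aa)).
Qed.
End Frames.

Lemma frame_change_unit {R : realType} {d : nat} {X : topologicalType}
    {a b : chart R d X} {x} : smoothly_compatible a b ->
  cdom a x -> cdom b x -> coordinate_frame (cfun a) b x \in unitmx.
Proof.
move=> ab ax bx.
have E : \forall u \near cfun a x, u = (cfun a \o cinv a) u.
  by apply: filterS (near_cinvK ax) => u /= ->.
have C1id : C1_at id (cfun a x).
  split; first exact: filterE.
  rewrite (_ : jacobian id = cst 1%:M); first exact: cst_continuous.
  by apply/funext => u; rewrite jacobian_id.
have [Ca Ja] := C1_at_near E C1id.
have ba : smoothly_compatible b a := conj ab.2 ab.1.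
have [_ H] := C1_frame_change ba bx ax (transition_C1 ab.2 bx ax).
have : coordinate_frame (cfun b) a x *m coordinate_frame (cfun a) b x = 1%:M.
  exact: etrans (esym H) (etrans Ja (jacobian_id _)).
by move=> /mulmx1_unit[].
Qed.

(** * Coordinate frames span the tangent planes *)
Section TangentSpaces.
Context {R : realType} {d D : nat} {X : topologicalType}.
Context {N : set 'rV[R]_D} {F : X -> 'rV[R]_D}.
Hypothesis N_sub : smooth_submanifold d N.
Hypothesis FN : forall x, N (F x).

Lemma euclidean_transition_C1 {a : chart R D 'rV[R]_D} {p} :
  smoothly_compatible (@euclidean_chart R D) a -> cdom a p ->
  [/\ C1_at (cfun a) p, C1_at (cinv a) (cfun a p),
      smooth_on (cfun a @` cdom a) (cinv a)
    & 'J (cfun a) p *m 'J (cinv a) (cfun a p) = 1%:M].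
Proof.
move=> ea ap.
have Ca : C1_at (cfun a) p := transition_C1 (x := p) ea.1 I ap.
have Ci : C1_at (cinv a) (cfun a p) := transition_C1 (x := p) ea.2 ap I.
have Sa : smooth_on (cfun a @` cdom a) (cinv a).
  by have := ea.2; rewrite /smooth_transition setIT.
have E : \forall q \near p, (cinv a \o cfun a) q = id q.
  by apply: filterS (near_cdom ap) => q; exact: cfunK.
have [_ J1] := C1_at_near E (C1_at_comp erefl Ca Ci).
split; [exact: Ca|exact: Ci|exact: Sa|].
apply: etrans (etrans (esym J1) (jacobian_id _)).
by apply/esym/(jacobian_comp erefl); exact: C1_at_differentiable.
Qed.

(** The obvious curve t |-> F (b^-1 (u + t w)) is only C^1 when [F] is, while a
tangent vector of [N] has to come from a smooth curve.  In a chart [a] of R^D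
flattening [N], the velocity [xi] of the image of that curve lies in the
coordinate [d]-plane, because the curve stays in [N]; the straight line with
velocity [xi], pulled back by [a], is a smooth curve in [N] with velocity [v]. *)
Lemma frame_tangent (b : chart R d X) x v :
  cdom b x -> C1_at (F \o cinv b) (cfun b x) ->
  (v <= coordinate_frame F b x)%MS -> tangent N (F x) v.
Proof.
move=> bx Fb /submxP[w vE].
have [a [ea ap aN]] := N_sub _ (FN x).
have [Ca Ci aS JK] := euclidean_transition_C1 ea ap.
set p := F x in ap Ca Ci JK *; set u := cfun b x in Fb.
have uE : (F \o cinv b) u = p by rewrite /= cfunK.
pose xi := v *m 'J (cfun a) p.
have dF := C1_at_differentiable Fb.
have da := C1_at_differentiable Ca.
have dh : differentiable (cfun a \o (F \o cinv b)) u.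
  by apply: differentiable_comp; rewrite ?uE.
have Fc : (F \o cinv b) @ u --> p.
  by have := differentiable_continuous dF; rewrite /prop_for /continuous_at uE.
have xiE : xi = 'D_w (cfun a \o (F \o cinv b)) u.
  apply/esym; apply: etrans (deriveEjacobian _ dh) _.
  by rewrite (jacobian_comp uE dF da) mulmxA -vE.
have xi0 (i : 'I_D) : (d <= i)%N -> xi ord0 i = 0.
  move=> di; rewrite xiE derive_mx; last exact: diff_derivable.
  rewrite mxE -(derive_cst (0 : R) u w); apply: near_eq_derive.
  have near_a : \forall u' \near u, cdom a ((F \o cinv b) u') by exact: Fc (near_cdom ap).
  by apply: filterS near_a => u' au'; apply: ((aN _ au').1 (FN _)).
have lc : (fun t : R^o => cfun a p + t *: xi) @ (0 : R^o) --> cfun a p.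
  have : (fun t : R^o => cfun a p + t *: xi) @ (0 : R^o) --> cfun a p + (0 : R) *: xi.
    by apply: cvgD; [exact: cvg_cst|apply: cvgZr_tmp; exact: cvg_id].
  by rewrite scale0r addr0.
have /nbhs_ballP[e /= e0 He] := lc _ (near_cimg ap).
exists e, (fun t => cinv a (cfun a p + t *: xi)); split=> //.
- by move=> k; apply: Ck_on_line (aS k) => //; exact: ball_open.
- move=> t /He /= [q aq qE]; rewrite -qE cfunK //; apply/(aN q aq) => i di.
  by rewrite qE mxE ((aN p ap).1 (FN x)) // mxE xi0 // mulr0 addr0.
- by rewrite scale0r addr0 cfunK.
- rewrite (derive1_along (cinv a)) deriveEjacobian.
    by rewrite /xi -mulmxA JK mulmx1.
  exact: C1_at_differentiable.
Qed.

(** One inclusion suffices, as both planes have dimension [d]. *)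
Lemma frame_og_plane (g : 'rV[R]_D -> ograss R d D) (b : chart R d X) x :
  oriented_gauss_map N g -> cdom b x -> C1_at (F \o cinv b) (cfun b x) ->
  row_free (coordinate_frame F b x) ->
  (coordinate_frame F b x == og_plane (g (F x)))%MS.
Proof.
move=> [gT _] bx Fb Ff.
have sub : (coordinate_frame F b x <= og_plane (g (F x)))%MS.
  apply/row_subP => i; apply/gT; first exact: FN.
  by apply: frame_tangent bx Fb _; exact: row_sub.
have [_ <-] := mxrank_leqif_eq sub.
by rewrite og_rank -row_leq_rank in Ff *; rewrite eqn_leq rank_leq_row.
Qed.
End TangentSpaces.

(** * Signs of coordinate frames *)
Section FrameSigns.
Context {R : realType} {d D : nat} {X : topologicalType}.
Context {A : set (chart R d X)} {N : set 'rV[R]_D} {F : X -> 'rV[R]_D}.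
Context {g : 'rV[R]_D -> ograss R d D}.
Hypothesis F_emb : Ck_embedding A 1 F.
Hypothesis N_sub : smooth_submanifold d N.
Hypothesis FN : forall x, N (F x).
Hypothesis g_gauss : oriented_gauss_map N g.
Implicit Types a b : chart R d X.

Definition frame_sign a x : bool := og_pos (g (F x)) (coordinate_frame F a x).

Lemma embedding_C1_at {a x} : A a -> cdom a x -> C1_at (F \o cinv a) (cfun a x).
Proof. by case: F_emb => FA _ _ _; exact: Ck_map_C1_at. Qed.

Lemma embedding_frame_plane a x : A a -> cdom a x ->
  (coordinate_frame F a x == og_plane (g (F x)))%MS.
Proof.
move=> Aa ax; have [_ Ff _ _] := F_emb.
exact: (frame_og_plane N_sub FN _ _ _ g_gauss ax (embedding_C1_at Aa ax) (Ff _ _ Aa ax)).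
Qed.

Lemma frame_sign_change a b x : A a -> cdom a x -> cdom b x ->
  smoothly_compatible a b ->
  (coordinate_frame F b x == og_plane (g (F x)))%MS /\
  frame_sign b x =
    frame_sign a x (+) (\det (coordinate_frame (cfun a) b x) < 0).
Proof.
move=> Aa ax bx ab.
have Tu := frame_change_unit ab ax bx.
have [_ FE] := C1_frame_change ab ax bx (embedding_C1_at Aa ax).
have P := embedding_frame_plane _ _ Aa ax.
rewrite /frame_sign FE; split; last by rewrite og_pos_change.
apply/eqmxP; apply: eqmx_trans (eqmxMfull _ _) (eqmxP P).
by rewrite row_full_unit.
Qed.

(** Near [x] the orientation has a continuous positively or negatively signed
basis [B]; the frame is [C *m B] with [C] continuous and invertible, so the sign
of \det C does not change near [x]. *)
Lemma near_frame_sign a x : A a -> cdom a x ->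
  \forall y \near x, frame_sign a y = frame_sign a x.
Proof.
move=> Aa ax; have [_ gO] := g_gauss.
have [U [B [b [oU Ux cB sB]]]] := gO _ (FN x).
have Fc := C1_chart_continuous ax (embedding_C1_at Aa ax).
have FU : \forall y \near x, U (F y) by apply: Fc; exact: open_nbhs_nbhs.
have BFc : B (F y) @[y --> x] --> B (F x).
  have /subspace_continuousP/(_ (F x) (conj (FN x) Ux)) := cB.
  apply: cvg_trans => W /= nW; have := Fc _ nW.
  by apply: filterS2 FU => y Uy WF; exact: WF (conj (FN y) Uy).
(* The only solution of frame = C *m B, computed by a right inverse of B so that
   its continuity is visible. *)
pose C y := coordinate_frame F a y *m (B (F y))^T *m invmx (B (F y) *m (B (F y))^T).
have Bf y : U (F y) -> row_free (B (F y)).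
  move=> Uy; have [/eqmxP BP _] := sB _ (FN y) Uy.
  by rewrite -row_leq_rank BP og_rank.
have CE y : cdom a y -> U (F y) ->
    C y \in unitmx /\ frame_sign a y = b (+) (\det (C y) < 0).
  move=> ay Uy; have [BP Bb] := sB _ (FN y) Uy.
  have FP := embedding_frame_plane _ _ Aa ay.
  have /submxP[w wE] : (coordinate_frame F a y <= B (F y))%MS.
    by rewrite (eqmxP FP) -(eqmxP BP).
  have Cw : C y = w.
    by rewrite /C wE -!mulmxA (mulmxA _ _ (invmx _)) mulmxV ?mulmx1 // -row_free_gram Bf.
  have wu : w \in unitmx.
    rewrite -row_free_unit -row_leq_rank.
    apply: leq_trans (mxrankM_maxl w (B (F y))); rewrite -wE.
    by rewrite (eqmxP FP) og_rank.
  by rewrite Cw /frame_sign wE og_pos_change // Bb.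
have Cc : C y @[y --> x] --> C x.
  have BTc : (B (F y))^T @[y --> x] --> (B (F x))^T by exact: cvg_trmx.
  apply: cvg_mulmx; first apply: cvg_mulmx => //.
    exact: cvg_frame ax (embedding_C1_at Aa ax).
  apply: cvg_invmx; first exact: cvg_mulmx.
  by rewrite -row_free_gram Bf.
have dC : \det (C y) @[y --> x] --> \det (C x) by exact: cvg_det.
have [Cu Sx] := CE x ax Ux.
have near_sgn : \forall y \near x, (\det (C y) < 0) = (\det (C x) < 0).
  have := Cu; rewrite unitmxE unitfE neq_lt => /orP[C0|C0].
    rewrite C0; near=> y; near: y; exact: (cvgr_lt _ dC).
  rewrite (lt_gtF C0); near=> y; apply: lt_gtF; near: y; exact: (cvgr_gt _ dC).
near=> y.
have ay : cdom a y by near: y; exact: near_cdom.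
have Uy : U (F y) by near: y; exact: FU.
have [_ ->] := CE y ay Uy.
by rewrite Sx; congr (_ (+) _); near: y.
Unshelve. all: by end_near. Qed.
End FrameSigns.

Section GlobalSign.
Context {R : realType} {d D : nat} {X : topologicalType}.
Context {A : set (chart R d X)} {N N' : set 'rV[R]_D} {F F' : X -> 'rV[R]_D}.
Context {g g' : 'rV[R]_D -> ograss R d D}.
Hypothesis A_atlas : smooth_atlas A.
Hypotheses (F_emb : Ck_embedding A 1 F) (F'_emb : Ck_embedding A 1 F').
Hypotheses (N_sub : smooth_submanifold d N) (N'_sub : smooth_submanifold d N').
Hypotheses (FN : forall x, N (F x)) (FN' : forall x, N' (F' x)).
Hypotheses (g_gauss : oriented_gauss_map N g) (g'_gauss : oriented_gauss_map N' g').

(** The comparison of the two signs does not depend on the chart, since both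
change by the same determinant; hence it is a locally constant function on
[X]. *)
Lemma connected_frame_sign : connected [set: X] ->
  exists s : bool, forall a x, A a -> cdom a x ->
    frame_sign (F := F) (g := g) a x = frame_sign (F := F') (g := g') a x (+) s.
Proof.
move=> conX; have [A_cover A_compat] := A_atlas.
(* [q a x] compares the two signs; hiding its definition keeps terms small. *)
have [q qE] : exists q : chart R d X -> X -> bool, forall a x,
    q a x = frame_sign (F := F) (g := g) a x (+) frame_sign (F := F') (g := g') a x.
  by eexists => a x; reflexivity.
have qchange a b x : A a -> A b -> cdom a x -> cdom b x -> q b x = q a x.
  move=> Aa Ab ax bx; have ab := A_compat _ _ Aa Ab.
  have [_ E] := frame_sign_change F_emb N_sub FN g_gauss _ _ _ Aa ax bx ab.
  have [_ E'] := frame_sign_change F'_emb N'_sub FN' g'_gauss _ _ _ Aa ax bx ab.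
  by rewrite !qE E E' addbACA addbb addbF.
have qnear a x : A a -> cdom a x -> \forall y \near x, cdom a y /\ q a y = q a x.
  move=> Aa ax.
  have H1 := near_frame_sign F_emb N_sub FN g_gauss _ _ Aa ax.
  have H2 := near_frame_sign F'_emb N'_sub FN' g'_gauss _ _ Aa ax.
  apply: filterS2 (near_cdom ax) (filterI H1 H2) => y ay [E1 E2].
  by split; [exact: ay|rewrite !qE; exact: congr2 E1 E2].
have [x0|noX] := pselect (exists x : X, True); last first.
  by exists false => a x; case: noX; exists x.
have [x _] := x0; have [a Aa ax] := A_cover x.
pose S := [set y | exists b, [/\ A b, cdom b y & q b y = q a x]].
have oS : open S.
  rewrite openE => y [b [Ab byy qb]].
  by apply: filterS (qnear b y Ab byy) => z [bz qz]; exists b; rewrite qz.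
have cS : closed S.
  rewrite -openC openE => y nSy; have [b Ab byy] := A_cover y.
  apply: filterS (qnear b y Ab byy) => z [bz qz] [b' [Ab' b'z qb']].
  apply: nSy; exists b; split=> //.
  by rewrite -qz -qb'; apply: qchange.
have ST : S = [set: X].
  apply: conX; first by exists x, a.
    by exists S => //; rewrite setTI.
  by exists S => //; rewrite setTI.
exists (q a x) => b y Ab byy.
have [b' [Ab' b'y <-]] : S y by rewrite ST.
rewrite (qchange b b' y Ab Ab' byy b'y) qE addbC.
by rewrite addbK.
Qed.
End GlobalSign.

(** * C^1 convergence of frames *)
Section Whitney.
Context {R : realType}.

Lemma norm_le_enorm {n} (v : 'rV[R]_n) : `|v| <= enorm v.
Proof.
rewrite [`|v|]mx_normrE; apply: bigmax_le => [|[i j] _]; first exact: sqrtr_ge0.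
rewrite ord1 /= -sqrtr_sqr /enorm ler_sqrt; last first.
  by apply: sumr_ge0 => k _; exact: sqr_ge0.
by rewrite (bigD1 j) //= lerDl; apply: sumr_ge0 => k _; exact: sqr_ge0.
Qed.

Lemma norm_lt_rows {m n} (M : 'M[R]_(m, n)) (e : R) : 0 < e ->
  (forall i, `|row i M| < e) -> `|M| < e.
Proof.
move=> e0 He; rewrite [`|M|]mx_normrE; apply: bigmax_lt => // -[i j] _ /=.
apply: le_lt_trans (He i); rewrite [`|row i M|]mx_normrE.
apply: le_trans (le_bigmax _ _ (ord0, j)); by rewrite /= mxE.
Qed.

Lemma uniform_cvg_joint {X : topologicalType} {V : normedModType R}
    (U : set X) (f : nat -> X -> V) (foo : X -> V) (x0 : X) :
  nbhs x0 U ->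
  (forall e : R, 0 < e -> exists n, forall i, (n <= i)%N ->
     forall x, U x -> `|f i x - foo x| < e) ->
  foo x @[x --> x0] --> foo x0 ->
  f z.2 z.1 @[z --> filter_prod (nbhs x0) \oo] --> foo x0.
Proof.
move=> nU funi fooc; apply/cvgrPdist_lt => e e0.
have e2 : 0 < e / 2 by rewrite divr_gt0.
have [n Hn] := funi _ e2.
have foo_near : \forall x \near x0, `|foo x0 - foo x| < e / 2.
  by move/cvgrPdist_lt : fooc; exact.
exists (U `&` [set x | `|foo x0 - foo x| < e / 2], [set i | (n <= i)%N]) => /=.
  split; first exact: filterI.
  by exists n.
move=> [x i] /= [[Ux xe] ni].
rewrite -(subrKA (foo x)) (splitr e) (le_lt_trans (ler_normD _ _)) // ltrD //.
by rewrite distrC; exact: Hn.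
Qed.

(** Whitney convergence is expressed in a chart [psi] of the target; the chain
rule recovers the frame of [F] from the Jacobian in that chart. *)
Lemma frame_in_target_chart {d D} {X : topologicalType} {F : X -> 'rV[R]_D}
    {b : chart R d X} {psi : chart R D 'rV[R]_D} {x} :
  smoothly_compatible (@euclidean_chart R D) psi ->
  cdom b x -> cdom psi (F x) -> C1_at (F \o cinv b) (cfun b x) ->
  C1_at (cfun psi \o F \o cinv b) (cfun b x) /\
  coordinate_frame F b x =
    'J (cfun psi \o F \o cinv b) (cfun b x) *m 'J (cinv psi) (cfun psi (F x)).
Proof.
move=> epsi bx psix CF.
have [Cpsi _ _ JK] := euclidean_transition_C1 epsi psix.
have Ex : (F \o cinv b) (cfun b x) = F x by rewrite /= cfunK.
split; first exact: (C1_at_comp Ex CF Cpsi).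
have JE : 'J (cfun psi \o F \o cinv b) (cfun b x) =
    coordinate_frame F b x *m 'J (cfun psi) (F x).
  by apply: (jacobian_comp Ex); exact: C1_at_differentiable.
by rewrite JE -mulmxA JK mulmx1.
Qed.

Context {d D : nat} {X : topologicalType} {A : set (chart R d X)}.
Context {F : nat -> X -> 'rV[R]_D} {Foo : X -> 'rV[R]_D}.
Hypothesis A_cover : forall x, exists2 a, A a & cdom a x.
Hypothesis F_C1 : forall i, Ck_map A 1 (F i).
Hypothesis Foo_C1 : Ck_map A 1 Foo.
Hypothesis F_cvg : whitney_C1_cvg A F Foo.

Lemma compatible_C1_at (G : X -> 'rV[R]_D) b x : Ck_map A 1 G ->
  (forall a, A a -> smoothly_compatible a b) -> cdom b x ->
  C1_at (G \o cinv b) (cfun b x).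
Proof.
move=> GC Ab bx; have [a Aa ax] := A_cover x.
by have [] := C1_frame_change (Ab a Aa) ax bx (Ck_map_C1_at GC Aa ax).
Qed.

(** In the chart [q] of the target the values and Jacobians of [F i] converge
uniformly on the domain of [b], hence jointly in the point and in [i] because
those of [Foo] are continuous.  Composing with [cinv q], whose Jacobian is
continuous too, removes the target chart. *)
Lemma whitney_frame_cvg x0 : exists b : chart R d X,
  [/\ cdom b x0, forall a, A a -> smoothly_compatible a b,
      F z.2 z.1 @[z --> filter_prod (nbhs x0) \oo] --> Foo x0
    & coordinate_frame (F z.2) b z.1 @[z --> filter_prod (nbhs x0) \oo]
        --> coordinate_frame Foo b x0].
Proof.
have [I [phi [psi [[phiA phi_cover _] [epsi _ _] Foo_psi F_psi]]]] := F_cvg.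
have [al bx0] := phi_cover x0.
set b := phi al in bx0 *; set q := psi al.
have Ab a : A a -> smoothly_compatible a b by exact: phiA.
have eucl_q : smoothly_compatible (@euclidean_chart R D) q by exact: epsi.
have Foo_q x : cdom b x -> cdom q (Foo x) by move=> bx; apply: (Foo_psi al); exists x.
have CF i x (bx : cdom b x) : C1_at (F i \o cinv b) (cfun b x).
  exact: (compatible_C1_at (F i) b x (F_C1 i) Ab bx).
have CFoo x (bx : cdom b x) : C1_at (Foo \o cinv b) (cfun b x).
  exact: (compatible_C1_at Foo b x Foo_C1 Ab bx).
exists b.
have close (e : R) : 0 < e -> exists n, forall i, (n <= i)%N -> forall x, cdom b x ->
    [/\ cdom q (F i x), `|cfun q (F i x) - cfun q (Foo x)| < e
      & `|'J (cfun q \o F i \o cinv b) (cfun b x) -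
          'J (cfun q \o Foo \o cinv b) (cfun b x)| < e].
  move=> e0; have [n Hn] := F_psi al e e0; exists n => i ni x bx.
  have [Fq sup] := Hn i ni.
  have qx : cdom q (F i x) by apply: Fq; exists x.
  have part beta : `|partial1 beta (cfun q \o F i \o cinv b) (cfun b x) -
                     partial1 beta (cfun q \o Foo \o cinv b) (cfun b x)| < e.
    apply: le_lt_trans (norm_le_enorm _) _; rewrite -lte_fin.
    apply: le_lt_trans (sup beta); apply: ereal_sup_ubound.
    by exists (cfun b x) => //; exists x.
  split; first exact: qx.
    by have := part None; rewrite /= cfunK.
  apply: norm_lt_rows => // k; rewrite linearB /=.
  have [Ci _] := frame_in_target_chart eucl_q bx qx (CF i x bx).
  have [Coo _] := frame_in_target_chart eucl_q bx (Foo_q x bx) (CFoo x bx).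
  have := part (Some k); rewrite /partial1.
  by rewrite -(jacobian_derive k (C1_at_differentiable Ci)) -(jacobian_derive k (C1_at_differentiable Coo)).
have nU : nbhs x0 (cdom b) by exact: near_cdom.
have qx0 : cdom q (Foo x0) by exact: Foo_q.
have [Coo frameoo] := frame_in_target_chart eucl_q bx0 qx0 (CFoo x0 bx0).
pose G := filter_prod (nbhs x0) (\oo : set_system nat).
have Gnear : \forall z \near G, cdom b z.1 /\ cdom q (F z.2 z.1).
  have [n Hn] := close 1 ltr01.
  exists (cdom b, [set i | (n <= i)%N]) => /=; first by split=> //; exists n.
  by move=> [x i] /= [bx ni]; have [] := Hn i ni x bx.
have valc : cfun q (F z.2 z.1) @[z --> G] --> cfun q (Foo x0).
  apply: (uniform_cvg_joint (cdom b) (fun i x => cfun q (F i x)) (cfun q \o Foo)) => //.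
    move=> e /close[n Hn]; exists n => i ni x bx.
    by have [] := Hn i ni x bx.
  exact: cvg_comp (C1_chart_continuous bx0 (CFoo x0 bx0)) (cfun_continuous qx0).
have jacc : 'J (cfun q \o F z.2 \o cinv b) (cfun b z.1) @[z --> G] -->
    'J (cfun q \o Foo \o cinv b) (cfun b x0).
  apply: (uniform_cvg_joint (cdom b)
    (fun i x => 'J (cfun q \o F i \o cinv b) (cfun b x))
    (fun x => 'J (cfun q \o Foo \o cinv b) (cfun b x))) => //.
    move=> e /close[n Hn]; exists n => i ni x bx.
    by have [] := Hn i ni x bx.
  by have [_ JF] := Coo; exact: cvg_comp (cfun_continuous bx0) JF.
split; [exact: bx0|exact: Ab| |].
- have H : cinv q (cfun q (F z.2 z.1)) @[z --> G] --> cinv q (cfun q (Foo x0)).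
    exact: cvg_comp valc (cinv_continuous qx0).
  have nH : {near G, (fun z => cinv q (cfun q (F z.2 z.1))) =1 (fun z => F z.2 z.1)}.
    by apply: filterS Gnear => z [_ qz]; rewrite cfunK.
  rewrite -[X in _ --> X](cfunK qx0).
  exact: cvg_trans (near_eq_cvg nH) H.
- have [_ Ci _ _] := euclidean_transition_C1 eucl_q qx0.
  have H : 'J (cfun q \o F z.2 \o cinv b) (cfun b z.1) *m
      'J (cinv q) (cfun q (F z.2 z.1)) @[z --> G] --> coordinate_frame Foo b x0.
    rewrite frameoo; apply: (cvg_mulmx (F := G)); first exact: jacc.
    by have [_ JC] := Ci; exact: cvg_comp valc JC.
  apply: cvg_trans H; apply: near_eq_cvg.
  apply: filterS Gnear => z [bz qz].
  by have [_ E] := frame_in_target_chart eucl_q bz qz (CF z.2 z.1 bz); exact: esym.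
Qed.
End Whitney.

(** * Matching the two Gauss graphs *)
Section GaussGraphs.
Context {R : realType} {d D : nat} {X : Type}.
Implicit Types (F : X -> 'rV[R]_D) (g : 'rV[R]_D -> ograss R d D).

Definition gauss_point F g x : egrass R d D := (F x, g (F x)).

(** The matching sends the point over [F x] to the point over [F' x]; the value
outside the Gauss graph of [F] is arbitrary. *)
Definition transfer F F' g' (z : egrass R d D) : egrass R d D :=
  if pselect (exists x, F x = z.1) is left Fz then gauss_point F' g' (sval (cid Fz))
  else z.

Lemma transferE F F' g g' x : injective F ->
  transfer F F' g' (gauss_point F g x) = gauss_point F' g' x.
Proof.
move=> injF; rewrite /transfer; case: pselect => [Fz|[]]; last by exists x.
by case: cid => y /= /injF ->.
Qed.

Lemma gauss_cech_interleaved (c : R) (e : {nonneg R}) (k : fieldType) (j : nat)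
    F F' g g' (s : bool) :
  injective F -> injective F' ->
  (forall x, reversal_close c s e%:num (gauss_point F' g' x) (gauss_point F g x)) ->
  (forall x, reversal_close c s e%:num (gauss_point F g x) (gauss_point F' g' x)) ->
  interleaved e (gauss_cech_homology c k (range F) g j)
                (gauss_cech_homology c k (range F') g' j).
Proof.
move=> injF injF' FF' F'F.
apply: (cech_interleaved (f := transfer F F' g') (h := transfer F' F g)).
- by move=> _ [_ [x _ <-] <-]; rewrite (transferE F F' g g') //; exists (F' x) => //; exists x.
- by move=> _ [_ [x _ <-] <-]; rewrite (transferE F' F g' g) //; exists (F x) => //; exists x.
- by move=> _ [_ [x _ <-] <-]; rewrite (transferE F F' g g') // (transferE F' F g' g).
- by move=> _ [_ [x _ <-] <-]; rewrite (transferE F' F g' g) // (transferE F F' g g').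
- apply: (shadow_almost_isometric c (s := s)) => _ [_ [x _ <-] <-].
  by rewrite (transferE F F' g g') //; exact: FF'.
- apply: (shadow_almost_isometric c (s := s)) => _ [_ [x _ <-] <-].
  by rewrite (transferE F' F g' g) //; exact: F'F.
Qed.
End GaussGraphs.

(** * Uniform closeness and conclusion *)
Section ShortPaths.
Context {R : realType} {d D : nat} {X : topologicalType} {A : set (chart R d X)}.
Context {M : nat -> set 'rV[R]_D} {Moo : set 'rV[R]_D}.
Context {g : nat -> 'rV[R]_D -> ograss R d D} {goo : 'rV[R]_D -> ograss R d D}.
Context {F : nat -> X -> 'rV[R]_D} {Foo : X -> 'rV[R]_D} {s : nat -> bool}.
Hypothesis A_atlas : smooth_atlas A.
Hypothesis M_smooth : forall i, smooth_submanifold d (M i).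
Hypothesis Moo_smooth : smooth_submanifold d Moo.
Hypothesis g_gauss : forall i, oriented_gauss_map (M i) (g i).
Hypothesis goo_gauss : oriented_gauss_map Moo goo.
Hypothesis FM : forall i x, M i (F i x).
Hypothesis FooM : forall x, Moo (Foo x).
Hypothesis F_emb : forall i, Ck_embedding A 1 (F i).
Hypothesis Foo_emb : Ck_embedding A 1 Foo.
Hypothesis F_cvg : whitney_C1_cvg A F Foo.
Hypothesis s_sign : forall i a x, A a -> cdom a x ->
  frame_sign (F := F i) (g := g i) a x =
  frame_sign (F := Foo) (g := goo) a x (+) s i.

(** The pairs of frames of [F i] and [Foo] in the chart of [whitney_frame_cvg]
are eventually within the radius of [straight_segment_short] around the frame of
[Foo] at [x0], and after reversal by [s i] they have equal signs. *)
Lemma near_short_paths (c e : R) (x0 : X) : 0 < e ->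
  \forall x \near x0 & i \near \oo,
    reversal_close c (s i) e (gauss_point Foo goo x) (gauss_point (F i) (g i) x) /\
    reversal_close c (s i) e (gauss_point (F i) (g i) x) (gauss_point Foo goo x).
Proof.
move=> e0; have [A_cover A_compat] := A_atlas.
have F_C1 i : Ck_map A 1 (F i) by case: (F_emb i).
have Foo_C1 : Ck_map A 1 Foo by case: Foo_emb.
have [b [bx0 Ab Fc framec]] := whitney_frame_cvg A_cover F_C1 Foo_C1 F_cvg x0.
pose G := filter_prod (nbhs x0) (\oo : set_system nat).
have Foo_b : C1_at (Foo \o cinv b) (cfun b x0).
  exact: (compatible_C1_at A_cover Foo b x0 Foo_C1 Ab bx0).
have signs i x : cdom b x ->
    [/\ (coordinate_frame Foo b x == og_plane (goo (Foo x)))%MS,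
        (coordinate_frame (F i) b x == og_plane (g i (F i x)))%MS
      & frame_sign (F := F i) (g := g i) b x =
        frame_sign (F := Foo) (g := goo) b x (+) s i].
  move=> bx; have [a Aa ax] := A_cover x.
  have [P1 S1] := frame_sign_change Foo_emb Moo_smooth FooM goo_gauss
    _ _ _ Aa ax bx (Ab a Aa).
  have [P2 S2] := frame_sign_change (F_emb i) (M_smooth i) (FM i) (g_gauss i)
    _ _ _ Aa ax bx (Ab a Aa).
  split; [exact: P1|exact: P2|].
  apply: etrans S2 _; apply: etrans (esym (congr1 (addb^~ (s i)) S1)).
  by rewrite s_sign // addbAC.
have X0f : row_free (coordinate_frame Foo b x0).
  by have [P _ _] := signs 0%N x0 bx0; rewrite -row_leq_rank (eqmxP P) og_rank.
have [r r0 Hr] := straight_segment_short c _ e X0f e0.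
have r20 : 0 < r / 2 by rewrite divr_gt0.
have c1 : z.1 @[z --> G] --> x0 by exact: cvg_fst.
have Fooc : Foo z.1 @[z --> G] --> Foo x0.
  exact: cvg_comp c1 (C1_chart_continuous bx0 Foo_b).
have frameooc : coordinate_frame Foo b z.1 @[z --> G] --> coordinate_frame Foo b x0.
  exact: cvg_comp c1 (cvg_frame bx0 Foo_b).
have N1 : \forall z \near G, cdom b z.1 by exact: c1 (near_cdom bx0).
have N2 : \forall z \near G, `|coordinate_frame Foo b x0 - coordinate_frame (F z.2) b z.1| < r.
  exact: cvgr_dist_lt framec _ r0.
have N3 : \forall z \near G, `|coordinate_frame Foo b x0 - coordinate_frame Foo b z.1| < r.
  exact: cvgr_dist_lt frameooc _ r0.
have N4 : \forall z \near G, `|Foo x0 - F z.2 z.1| < r / 2.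
  exact: cvgr_dist_lt Fc _ r20.
have N5 : \forall z \near G, `|Foo x0 - Foo z.1| < r / 2.
  exact: cvgr_dist_lt Fooc _ r20.
apply: filterS2 (filterI N1 (filterI N2 N3)) (filterI N4 N5).
move=> [x i] /= [bx [fi foo]] [vi voo].
have dv : `|Foo x - F i x| < r.
  rewrite -(subrKA (Foo x0)) (splitr r) (le_lt_trans (ler_normD _ _)) // ltrD //.
  by rewrite distrC.
have [P1 P2 S] := signs i x bx.
split.
  apply: (Hr (gauss_point Foo goo x) (reverse_point (s i) (gauss_point (F i) (g i) x))
    (frame_sign (F := Foo) (g := goo) b x)
    (coordinate_frame Foo b x) (coordinate_frame (F i) b x) dv foo fi).
    by split; [exact: P1|].
  by apply/signed_basis_reverse_if; split; [exact: P2|exact: S].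
apply: (Hr (gauss_point (F i) (g i) x) (reverse_point (s i) (gauss_point Foo goo x))
  (frame_sign (F := F i) (g := g i) b x)
  (coordinate_frame (F i) b x) (coordinate_frame Foo b x) _ fi foo).
- by rewrite /= distrC; exact: dv.
- by split; [exact: P2|].
- apply/signed_basis_reverse_if; split; first exact: P1.
  by rewrite S addbK.
Qed.
End ShortPaths.

Lemma interleaving_distance_cvg0 {R : realType} {k : fieldType}
    (V : nat -> pmodule R k) (W : pmodule R k) :
  (forall e : {nonneg R}, 0 < e%:num -> \forall i \near \oo, interleaved e (V i) W) ->
  (fun i => interleaving_distance (V i) W) @ \oo --> (0%E : \bar R).
Proof.
move=> H.
have ge0 i : (0 <= interleaving_distance (V i) W)%E.
  by apply: le_ereal_inf_tmp => _ [e _ <-]; rewrite lee_fin.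
have le_e (e : R) : 0 < e -> \forall i \near \oo, (interleaving_distance (V i) W <= e%:E)%E.
  move=> e0; apply: filterS (H (NngNum (ltW e0)) e0) => i Hi.
  by apply: ereal_inf_lbound; exists (NngNum (ltW e0)).
apply/fine_cvgP; split.
  apply: filterS (le_e 1 ltr01) => i le1.
  by rewrite ge0_fin_numE // (le_lt_trans le1) // ltry.
apply/cvgrPdist_le => e e0; apply: filterS (le_e e e0) => i lee.
have fi : interleaving_distance (V i) W \is a fin_num.
  by rewrite ge0_fin_numE // (le_lt_trans lee) // ltry.
by rewrite sub0r normrN /= ger0_norm ?fine_ge0 // -lee_fin fineK.
Qed.

Theorem theorem1p4 (R : realType) (d D : nat)
  (M : nat -> set 'rV[R]_D) (Moo : set 'rV[R]_D)
  (g : nat -> 'rV[R]_D -> ograss R d D) (goo : 'rV[R]_D -> ograss R d D)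
  (M_sub : forall i, closed_oriented_submanifold (M i) (g i))
  (Moo_sub : closed_oriented_submanifold Moo goo)
  (X : topologicalType) (A : set (chart R d X)) (X_closed : closed_manifold A)
  (F : nat -> X -> 'rV[R]_D) (Foo : X -> 'rV[R]_D)
  (F_emb : forall i k, Ck_embedding A k (F i)) (Foo_emb : Ck_embedding A 1 Foo)
  (F_range : forall i, range (F i) = M i) (Foo_range : range Foo = Moo)
  (F_cvg : whitney_C1_cvg A F Foo)
  (F_or : connected [set: X] \/ compatible_orientations A F Foo g goo)
  (c : R) (c_gt0 : 0 < c) (k : fieldType) (j : nat) :
  (fun i => interleaving_distance (gauss_cech_homology c k (M i) (g i) j)
                                  (gauss_cech_homology c k Moo goo j))
    @ \oo --> (0%E : \bar R).
Proof.
have [_ _ cptX [A_cover A_compat]] := X_closed.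
have FM i x : M i (F i x) by rewrite -F_range; exists x.
have FooM x : Moo (Foo x) by rewrite -Foo_range; exists x.
have [_ Moo_smooth goo_gauss] := Moo_sub.
have M_smooth i : smooth_submanifold d (M i) by case: (M_sub i).
have g_gauss i : oriented_gauss_map (M i) (g i) by case: (M_sub i).
have /choice[s sE] : compatible_orientations A F Foo g goo.
  case: F_or => // conX i.
  exact: (connected_frame_sign (conj A_cover A_compat) (F_emb i 1%N) Foo_emb
    (M_smooth i) Moo_smooth (FM i) FooM (g_gauss i) goo_gauss conX).
apply: interleaving_distance_cvg0 => e e0.
pose close i x :=
  reversal_close c (s i) e%:num (gauss_point Foo goo x) (gauss_point (F i) (g i) x) /\
  reversal_close c (s i) e%:num (gauss_point (F i) (g i) x) (gauss_point Foo goo x).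
have near_close : \forall i \near \oo, [set: X] `<=` close i.
  have /compact_near_coveringP covX := cptX; apply: covX => x0 _.
  exact: (near_short_paths (conj A_cover A_compat) M_smooth Moo_smooth g_gauss
    goo_gauss FM FooM (fun i => F_emb i 1%N) Foo_emb F_cvg sE c e%:num x0 e0).
apply: filterS near_close => i Hi.
rewrite -F_range -Foo_range; apply: (gauss_cech_interleaved _ _ _ _ _ _ _ _ (s i)).
- by case: (F_emb i 1%N).
- by case: Foo_emb.
- by move=> x; have [] := Hi x I.
- by move=> x; have [] := Hi x I.
Qed.
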